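(* Let $q$ be a prime power, $n\ge1$ and $0\le m\le n^{1/2}$. (2) Let $a=\pm1$. The number of polynomials $f\in\mathcal P^*_a(n)$ which factor as $gg^*h$ with $\deg h\le m$ is $\ll|\mathcal P^*_a(n)|(m+1)/n^{1/2}$. (3) Assume $q$ is a square and let $a\in U$. The number of polynomials $f\in\mathcal P^\dagger_a(n)$ which factor as $gg^\dagger h$ with $\deg h\le m$ is $\ll q^{(n-1)/2}(m+1)/n^{1/2}$.
   Context: $X\ll Y$ means $X\le CY$ for an absolute constant $C$. All polynomials are monic over $\mathbf F_q$. For $f$ of degree $n$ with $f(0)\ne0$, let $f^*(X)=X^nf(1/X)/f(0)$; $f$ is $*$-symmetric if $f^*=f$. If $q$ is a square, let $\bar x=x^{q^{1/2}}$ for $x\in\mathbf F_q$, let $\bar f$ be $f$ with this map applied to its coefficients, and let $f^\dagger(X)=X^n\bar f(1/X)/\bar f(0)$; $f$ is $\dagger$-symmetric if $f^\dagger=f$. $U\le\mathbf F_q^\times$ is the cyclic subgroup of order $q^{1/2}+1$. $\mathcal P^*_a(n)$ (for $a=\pm1$) and $\mathcal P^\dagger_a(n)$ (for $a\in U$) are the sets of $*$-symmetric, respectively $\dagger$-symmetric, polynomials of degree $n$ with $f(0)=a$. *)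

(* Defs.v *)
From HB Require Import structures.
From mathcomp Require Import all_boot all_order all_algebra all_fingroup.
From mathcomp Require Import all_solvable all_field.
From mathcomp Require Import qpoly.
From mathcomp Require Import boolp reals exp.

Set Implicit Arguments.
Unset Strict Implicit.
Unset Printing Implicit Defensive.

Import Order.TTheory GRing.Theory Num.Theory.
Local Open Scope ring_scope.

(* X^n f(1/X), where n = deg f. *)
Definition poly_rev (F : fieldType) (f : {poly F}) : {poly F} :=
  \poly_(i < size f) f`_((size f).-1 - i).

(* f^*, meaningful only when f(0) != 0. *)
Definition poly_star (F : fieldType) (f : {poly F}) : {poly F} :=
  f.[0]^-1 *: poly_rev f.

(* q0 stands for q^(1/2); it is used with #|F| = q0 ^ 2 only. *)
Definition poly_bar (F : fieldType) (q0 : nat) (f : {poly F}) : {poly F} :=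
  map_poly (fun x => x ^+ q0) f.

(* f^dagger = X^n bar f (1/X) / bar f (0), where n = deg f = deg (bar f);
   meaningful only when f(0) != 0. *)
Definition poly_dagger (F : fieldType) (q0 : nat) (f : {poly F}) : {poly F} :=
  (poly_bar q0 f).[0]^-1 *: poly_rev (poly_bar q0 f).

Definition star_symmetric (F : fieldType) (f : {poly F}) : bool :=
  (f.[0] != 0) && (poly_star f == f).

Definition dagger_symmetric (F : fieldType) (q0 : nat) (f : {poly F}) : bool :=
  (f.[0] != 0) && (poly_dagger q0 f == f).

(* {poly_n.+1 F} is the type of polynomials of size at most n.+1. *)
Definition P_star (F : finFieldType) (n : nat) (a : F) : {set {poly_n.+1 F}} :=
  [set f : {poly_n.+1 F} |
    [&& polyn f \is monic, size f == n.+1, star_symmetric f & f.[0] == a]].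

Definition P_dagger (F : finFieldType) (q0 n : nat) (a : F) :
    {set {poly_n.+1 F}} :=
  [set f : {poly_n.+1 F} |
    [&& polyn f \is monic, size f == n.+1, dagger_symmetric q0 f & f.[0] == a]].

Definition star_factors (F : fieldType) (R : realType) (m : R) (f : {poly F}) :
    Prop :=
  exists g h : {poly F},
    [/\ g \is monic, g.[0] != 0, h \is monic, ((size h).-1)%:R <= m
      & f = g * poly_star g * h].

Definition dagger_factors (F : fieldType) (q0 : nat) (R : realType) (m : R)
    (f : {poly F}) : Prop :=
  exists g h : {poly F},
    [/\ g \is monic, g.[0] != 0, h \is monic, ((size h).-1)%:R <= m
      & f = g * poly_dagger q0 g * h].

(* The subgroup U exists and is unique, so a statement quantified over all
   cyclic subgroups of order q^(1/2) + 1 is a statement about this single one. *)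
Lemma cyclic_subgroup_exists (F : finFieldType) (q0 : nat) :
  #|F| = (q0 ^ 2)%N ->
  exists! U : {group {unit F}}, cyclic U && (#|U| == q0.+1).
Proof.
move=> hF.
have cF : cyclic [set: {unit F}] := field_unit_group_cyclic [group of [set: {unit F}]].
have q1 : (1 < q0)%N.
  have := finNzRing_gt1 F; rewrite hF.
  by case: (q0) => [|[|?]].
have /cyclicP[x xE] := cF.
have ox : #[x]%g = (q0.-1 * q0.+1)%N.
  rewrite orderE -xE card_finField_unit hF.
  by case: (q0) q1 => // k _; rewrite -mulnn mulSn [in RHS]mulnS.
exists <[x ^+ q0.-1]>%G; split.
  rewrite cycle_cyclic /= -orderE orderXdiv ox ?dvdn_mulr // mulKn //.
  by case: (q0) q1.
move=> V /andP[_ /eqP oV]; apply/val_inj/eqP => /=.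
rewrite (eq_subG_cyclic cF) ?subsetT // oV.
rewrite -orderE orderXdiv ox ?dvdn_mulr // mulKn //.
by case: (q0) q1.
Qed.

(* Main.v *)
Require Import Defs.
From HB Require Import structures.
From mathcomp Require Import all_boot all_order all_algebra all_fingroup.
From mathcomp Require Import all_solvable all_field.
From mathcomp Require Import qpoly.
From mathcomp Require Import boolp reals exp.
From mathcomp Require Import zify ring lra.

(** Write [q = #|F|], let [phi] be the identity or the half Frobenius, and call
    [norm g = g * recip g] the product of [g] with its (twisted) reciprocal.  If
    a self-reciprocal [f] is [norm g * h], then [h] is self-reciprocal too, so
    the polynomials to be counted are products of a norm and a self-reciprocal
    cofactor of degree at most [m].  Counting pairs trivially, each degree of
    [h] contributes as many pairs as there are self-reciprocal polynomials; what
    has to be saved is a factor [sqrt n] for each degree, and it comes from the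
    sparsity of norms: most norms arise from many [g], since any prime factor of
    [g] may be replaced by its reciprocal.

    Let [N d] be the number of norms of degree [2 * d].  Writing the degree of a
    norm [s] as the sum of [deg Q] over the prime powers [Q ^+ j] dividing [s], and
    observing that, unless [Q] is self-reciprocal, [Q ^+ j] forces a factor
    [norm (Q ^+ j)] of [s] whose cofactor is a norm ([dvd_exp_norm]), one obtains
    ([norm_num_rec])

      [2 * d * N d <= \sum_(1 <= e <= d) N (d - e) * (q ^ e + error)],

    because the von Mangoldt weight of degree [e] is [q ^ e - 1]; the error
    accounts for self-reciprocal primes, which are rare.  Were the error zero
    and the inequality an equality, [N d / q ^ d] would be the coefficient of
    [w ^ d] in [(1 - w) ^ (-1/2)], of order [1 / sqrt d].  A discrete Gronwall
    argument ([mass_sqr_le]) shows that the bound persists with an absolute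
    constant, using just [N d <= q ^ d] to control the error.

    Since [m <= sqrt n], the norm has degree comparable to [n], and it remains
    to count cofactors.  For the identity, norms have constant term 1, and
    passing from degree [k] to [k + 2 * d] multiplies the number of self-reciprocal
    polynomials by at least [q ^ d] ([size_self_recips_steps]).  For the half
    Frobenius, with [q = q0 ^ 2], there are at most [q0 ^ (k - 1)] cofactors of
    degree [k > 0] with given constant term ([size_self_recip_const]).  When
    [h = 1], the norm itself must have constant term [a], which has to save a
    factor [q0].  This follows by running the recursion once more
    ([norm_count_const]) with the constant term prescribed: prime powers are
    equidistributed over constant terms ([Lam_constE]), so the condition can be
    absorbed in the choice of the prime power, while the remaining norm is
    unrestricted and already controlled.

    The equidistribution is itself a consequence of the degree formula, summed
    over all polynomials with a given constant term. *)

Set Implicit Arguments.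
Unset Strict Implicit.
Unset Printing Implicit Defensive.

Import Order.TTheory GRing.Theory Num.Theory.
Local Open Scope ring_scope.

(** * Monic polynomials prime to 'X *)

Section MonicPolynomials.
Variable F : finFieldType.
Implicit Types (f g h p Q : {poly F}) (c : F).

(** Built by Horner's scheme, so that the elements with a given constant term
    in degree [k.+1] are visibly in bijection with those of degree [k]. *)
Fixpoint monics (n : nat) : seq {poly F} :=
  if n is k.+1 then [seq g * 'X + c%:P | g <- monics k, c <- enum F]
  else [:: 1].

Lemma poly_split f : exists g c, f = g * 'X + c%:P.
Proof.
elim/poly_ind: f => [|g c _]; last by exists g, c.
by exists 0, 0; rewrite mul0r add0r.
Qed.

Lemma MX_addC_inj g h (c d : F) :
  g * 'X + c%:P = h * 'X + d%:P -> g = h /\ c = d.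
Proof.
move=> /polyP E; have E0 := E 0%N; split; last first.
  by rewrite !coefD !coefMX !coefC /= !add0r in E0.
by apply/polyP => i; have := E i.+1; rewrite !coefD !coefMX !coefC /= !addr0.
Qed.

Lemma mem_monics n f : (f \in monics n) = (f \is monic) && (size f == n.+1).
Proof.
elim: n f => [|n IHn] f /=.
  rewrite inE; apply/eqP/andP => [->|[fm /size_poly1P[c c0 fE]]].
    by rewrite monic1 size_poly1.
  by move: fm; rewrite fE monicE lead_coefC => /eqP ->.
apply/allpairsP/andP => [[[g c] /= [gn _ ->]]|[fm /eqP fs]].
  move: gn; rewrite IHn => /andP[gm /eqP gs].
  have g0 : g != 0 by rewrite monic_neq0.
  split; last by rewrite size_MXaddC (negbTE g0) gs.
  rewrite monicE lead_coefDl ?lead_coefMX -?monicE //.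
  by rewrite size_mulX // gs size_polyC; case: (c != 0).
have [g [c fE]] := poly_split f.
exists (g, c) => /=; split=> //; last by rewrite mem_enum.
move: fs; rewrite fE size_MXaddC.
case: (boolP (_ && _)) => // gc [gs]; rewrite IHn gs eqxx andbT.
move: fm; rewrite fE !monicE lead_coefDl ?lead_coefMX //.
have g0 : g != 0 by rewrite -size_poly_eq0 gs.
by rewrite size_mulX // gs size_polyC; case: (c != 0).
Qed.

Lemma monics_uniq n : uniq (monics n).
Proof.
elim: n => [//|n IHn] /=; apply: allpairs_uniq => //; first exact: enum_uniq.
by move=> [g c] [h d] _ _ /= /MX_addC_inj[-> ->].
Qed.

Lemma size_monics n : size (monics n) = (#|F| ^ n)%N.
Proof.
by elim: n => [//|n IHn] /=; rewrite size_allpairs IHn -cardE expnSr.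
Qed.

Definition good f := (f \is monic) && (f.[0] != 0).

Lemma good_monic f : good f -> f \is monic. Proof. by case/andP. Qed.
Lemma good_neq0 f : good f -> f != 0.
Proof. by move=> /good_monic /monic_neq0. Qed.
Lemma good_const f : good f -> f.[0] != 0. Proof. by case/andP. Qed.

Lemma goodM f g : good f -> good (f * g) = good g.
Proof.
by case/andP=> fm f0; rewrite /good monicMl // hornerM mulf_eq0 negb_or f0.
Qed.

Lemma good1 : good 1. Proof. by rewrite /good monic1 hornerC oner_eq0. Qed.

Lemma goodX f j : good f -> good (f ^+ j).
Proof. by move=> fg; elim: j => [|j IH]; rewrite ?good1 // exprS goodM. Qed.

(** Only used on nonzero polynomials, where it is the true degree. *)
Definition deg f := (size f).-1.

Lemma deg1 : deg 1 = 0%N. Proof. by rewrite /deg size_poly1. Qed.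

Lemma degM f g : good f -> good g -> deg (f * g) = (deg f + deg g)%N.
Proof.
move=> fg gg; rewrite /deg size_mul ?good_neq0 //.
have := good_neq0 fg; have := good_neq0 gg.
rewrite -!size_poly_gt0; case: (size f) => // a; case: (size g) => // b _ _.
by rewrite addnS.
Qed.

Lemma degX f j : good f -> deg (f ^+ j) = (j * deg f)%N.
Proof.
move=> fg; elim: j => [|j IH]; first by rewrite expr0 deg1.
by rewrite exprS degM ?goodX // IH mulSn.
Qed.

Lemma size_good f : good f -> size f = (deg f).+1.
Proof. by move=> /good_neq0; rewrite -size_poly_gt0 /deg; case: (size f). Qed.

Lemma deg_eq0 f : good f -> (deg f == 0%N) = (f == 1).
Proof.
move=> fg; apply/eqP/eqP => [f0|->]; last exact: deg1.
have : f \in monics 0 by rewrite mem_monics good_monic //= size_good // f0.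
by rewrite inE => /eqP.
Qed.

Definition goods n := [seq f <- monics n | f.[0] != 0].

Lemma mem_goods n f : (f \in goods n) = good f && (deg f == n).
Proof.
rewrite mem_filter mem_monics /good andbA [in RHS]andbC [_ && (f \is _)]andbC.
rewrite [in RHS]andbC -andbA -[in RHS]andbA; case: (boolP (f \is monic)) => //= fm.
case: (f.[0] != 0) => //=; have := monic_neq0 fm.
by rewrite /deg -size_poly_gt0; case: (size f).
Qed.

Lemma goods_uniq n : uniq (goods n).
Proof. by rewrite filter_uniq ?monics_uniq. Qed.

Lemma size_goods n : (size (goods n) <= #|F| ^ n)%N.
Proof. by rewrite -size_monics size_filter count_size. Qed.

Lemma size_goods_const n c : c != 0 ->
  size [seq f <- goods n.+1 | f.[0] == c] = (#|F| ^ n)%N.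
Proof.
move=> c0; rewrite -size_monics.
rewrite -(size_map (fun g => g * 'X + c%:P) (monics n)).
apply/perm_size/uniq_perm.
- by rewrite filter_uniq ?goods_uniq.
- by rewrite map_inj_uniq ?monics_uniq // => g h /MX_addC_inj[].
move=> f; rewrite !mem_filter mem_monics.
apply/and3P/mapP => [[/eqP fc f0 fn]|[g gn ->]].
  have : f \in monics n.+1 by rewrite mem_monics.
  case/allpairsP=> -[g d] /= [gn _ fE]; exists g => //.
  by move: fc; rewrite fE !hornerE => <-.
have [] : [/\ (g * 'X + c%:P).[0] = c & g * 'X + c%:P \in monics n.+1].
  split; first by rewrite !hornerE.
  by apply/allpairsP; exists (g, c); split; rewrite // mem_enum.
by rewrite mem_monics => -> fn; rewrite eqxx c0.
Qed.

Lemma size_goods0_const c :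
  size [seq f <- goods 0 | f.[0] == c] = (c == 1).
Proof.
rewrite /goods /= hornerC oner_eq0 /= hornerC eq_sym.
by case: (c == 1).
Qed.

Lemma leq_size_cofactor (A B : seq {poly F}) p :
  uniq A -> {in A, forall f, exists2 g, g \in B & f = p * g} ->
  (size A <= size B)%N.
Proof.
move=> Au AB; rewrite -(size_map (fun g => p * g) B); apply: uniq_leq_size => //.
by move=> f /AB[g gB ->]; apply: map_f.
Qed.

Lemma good_dvdP p f : good p -> good f -> p %| f ->
  exists2 g, good g & f = p * g.
Proof.
move=> pg fg /dvdpP[g fE]; rewrite mulrC in fE; exists g => //.
by rewrite -(goodM g pg) -fE.
Qed.

(** Division by [p] turns a prescribed constant term into a prescribed constant
    term, so the multiples of [p] inside a residue class modulo 'X are counted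
    by a residue class in lower degree. *)
Lemma size_goods_dvd_const n e c p : good p -> deg p = e ->
  size [seq f <- [seq f <- goods (n + e) | f.[0] == c] | p %| f]
  = size [seq g <- goods n | g.[0] == c / p.[0]].
Proof.
move=> pg pe; rewrite -[RHS](size_map (fun g => p * g)).
apply/perm_size/uniq_perm.
- by rewrite !filter_uniq ?monics_uniq.
- rewrite map_inj_uniq ?filter_uniq ?monics_uniq //.
  exact: mulfI (good_neq0 pg).
move=> f; rewrite 2!mem_filter mem_goods.
apply/and3P/mapP => [[pf /eqP fc /andP[fg /eqP fn]]|[g]].
  have [g gg fE] := good_dvdP pg fg pf; exists g => //.
  rewrite mem_filter mem_goods gg /= -fc fE hornerM mulrC mulKf ?good_const // eqxx /=.
  by rewrite -(eqn_add2r e) -fn fE -pe degM // addnC.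
rewrite mem_filter mem_goods => /and3P[/eqP gc gg /eqP gn] ->.
rewrite dvdp_mulr // goodM // gg degM // pe gn addnC eqxx hornerM gc.
by rewrite mulrC divfK ?good_const.
Qed.

End MonicPolynomials.

(** * Prime powers and the von Mangoldt function *)

Section PrimePowers.
Variable F : finFieldType.
Implicit Types (f g h p Q P : {poly F}) (c : F).

Lemma good_of_dvd f q : good f -> q %| f ->
  exists2 g, good g & g %= q.
Proof.
move=> fg qf; have q0 : q != 0.
  by apply: contraTneq qf => ->; rewrite dvd0p good_neq0.
have l0 : (lead_coef q)^-1 != 0 by rewrite invr_eq0 lead_coef_eq0.
exists ((lead_coef q)^-1 *: q); last by rewrite eqp_scale.
rewrite /good monicE lead_coefZ mulVf ?lead_coef_eq0 // eqxx /=.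
rewrite hornerZ mulf_neq0 //; apply: contraNneq (good_const fg) => q00.
by case/dvdpP: qf => h ->; rewrite hornerM q00 mulr0.
Qed.

Lemma good_dvd_eqp f g : good f -> good g -> f %= g -> f = g.
Proof. by move=> fg gg; rewrite eqp_monic ?good_monic // => /eqP. Qed.

Lemma irreducible_divisor f : good f -> f != 1 ->
  exists P, [/\ good P, irreducible_poly P & P %| f].
Proof.
have [n] := ubnP (deg f); elim: n f => // n IH f; rewrite ltnS => fn fg f1.
case: (pselect (irreducible_poly f)) => [fi|fni]; first by exists f.
have f_gt0 : (0 < deg f)%N by rewrite lt0n deg_eq0.
have [q [q1 qf qnf]] : exists q : {poly F}, [/\ size q != 1%N, q %| f & ~~ (q %= f)].
  apply: contrapT => nq; apply: fni; split; first by rewrite size_good // ltnS.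
  by move=> q q1 qf; apply/idPn => qnf; apply: nq; exists q.
have [g gg gq] := good_of_dvd fg qf.
have gf : g %| f by rewrite (eqp_dvdl _ gq).
have gn : (deg g < n)%N.
  apply: leq_trans fn; rewrite ltn_neqAle -eqSS -!size_good //.
  rewrite dvdp_size_eqp // (eqp_ltrans gq) qnf /=.
  by rewrite -ltnS -!size_good // dvdp_leq // good_neq0.
have g1 : g != 1.
  by apply: contra q1 => /eqP g1; rewrite -(eqp_size gq) g1 size_poly1.
have [P [Pg Pi PP]] := IH g gn gg g1.
by exists P; split=> //; apply: dvdp_trans gf.
Qed.

Definition irreds (K : nat) : seq {poly F} :=
  undup [seq Q <- flatten [seq goods F k | k <- iota 0 K.+1] |
         `[< irreducible_poly Q >]].

Lemma irreds_uniq K : uniq (irreds K). Proof. exact: undup_uniq. Qed.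

Lemma mem_irreds K Q :
  (Q \in irreds K) = [&& `[< irreducible_poly Q >], good Q & (deg Q <= K)%N].
Proof.
rewrite mem_undup mem_filter; congr (_ && _).
apply/flatten_mapP/andP => [[k]|[Qg QK]].
  by rewrite mem_iota mem_goods add0n ltnS => kK /andP[-> /eqP ->].
by exists (deg Q); rewrite ?mem_iota ?ltnS // mem_goods Qg /=.
Qed.

Lemma irredsP K Q : Q \in irreds K ->
  [/\ irreducible_poly Q, good Q, (deg Q <= K)%N & (0 < deg Q)%N].
Proof.
rewrite mem_irreds => /and3P[/asboolP Qi Qg QK]; split=> //.
by case: Qi => + _; rewrite size_good // ltnS.
Qed.

Lemma irred_coprime P Q : irreducible_poly P -> good P -> good Q ->
  deg P = deg Q -> P != Q -> coprimep P Q.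
Proof.
move=> Pi Pg Qg PQ nPQ; rewrite irreducible_poly_coprime //.
apply: contra nPQ => /dvdp_size_eqp; rewrite !size_good // PQ eqxx => /esym.
by move/good_dvd_eqp=> ->.
Qed.

Lemma irreds_coprime K P Q : P \in irreds K -> Q \in irreds K -> P != Q ->
  coprimep P Q.
Proof.
move=> /irredsP[Pi Pg _ P0] /irredsP[[_ Qi] Qg _ _] PQ.
rewrite irreducible_poly_coprime //; apply: contra PQ => PQ.
apply/eqP/good_dvd_eqp => //; apply: Qi PQ.
by rewrite size_good // eqSS -lt0n.
Qed.

Lemma good_dvd_deg f p : good f -> good p -> p %| f -> (deg p <= deg f)%N.
Proof.
move=> fg pg pf; rewrite -ltnS -!size_good //.
by rewrite dvdp_leq // good_neq0.
Qed.

(** Unique factorisation in logarithmic form: the multiplicity of [Q] in [f] is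
    the number of [j >= 1] with [Q ^+ j %| f].  The bound [K] only makes the
    sums finite; leaving it free allows one list of primes to serve all the
    degrees that occur in a recursion. *)
Lemma deg_sum_irreds K f : good f -> (deg f <= K)%N ->
  (\sum_(Q <- irreds K) deg Q * \sum_(1 <= j < K.+1) (Q ^+ j %| f)%R = deg f)%N.
Proof.
have [n] := ubnP (deg f); elim: n f => // n IH f; rewrite ltnS => fn fg fK.
have [f1|f1] := eqVneq f 1.
  rewrite f1 deg1 big_seq big1 // => Q /irredsP[_ Qg _ Q0].
  rewrite big_nat big1 ?muln0 // => j /andP[j1 _].
  rewrite (_ : _ %| _ = false) //; apply/negbTE/negP => /good_dvd_deg.
  rewrite goodX ?good1 // deg1 degX // => /(_ isT isT).
  by rewrite leqn0 muln_eq0 !eqn0Ngt j1 Q0.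
have [P [Pg Pi /good_dvdP[] // g gg fE]] := irreducible_divisor fg f1.
have P0 : (0 < deg P)%N by case: Pi => + _; rewrite size_good // ltnS.
have dfE : deg f = (deg P + deg g)%N by rewrite fE degM.
have PK : P \in irreds K.
  by rewrite mem_irreds Pg asboolT //= (leq_trans _ fK) // dfE leq_addr.
have gn : (deg g < n)%N by apply: leq_trans fn; rewrite dfE -{1}[deg g]add0n ltn_add2r.
have gK : (deg g < K)%N.
  by apply: leq_trans fK; rewrite dfE -{1}[deg g]add0n ltn_add2r.
have := IH g gn gg (ltnW gK).
rewrite (bigD1_seq P) ?irreds_uniq //= => IHg.
rewrite (bigD1_seq P) ?irreds_uniq //= dfE -IHg addnA; congr (_ + _)%N.
  rewrite -mulnS; congr (_ * _)%N.
  rewrite (eq_big_nat _ _ (F2 := fun j => ((P ^+ j.-1 %| g)%R : nat))); last first.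
    move=> [//|j] _; rewrite fE exprS dvdp_mul2l //; exact: good_neq0.
  rewrite big_add1 big_ltn ?(leq_ltn_trans _ gK) //= expr0 dvd1p add1n.
  congr _.+1; rewrite big_nat_recr ?(leq_ltn_trans _ gK) //=.
  rewrite (_ : P ^+ K %| g = false) ?addn0 //.
  apply/negbTE/negP => /good_dvd_deg; rewrite goodX // degX // => /(_ gg isT).
  by rewrite leqNgt (leq_trans gK) // leq_pmulr.
rewrite big_seq_cond [RHS]big_seq_cond; apply: eq_bigr => Q /andP[QK QP].
congr (_ * _)%N; apply: eq_bigr => j _; rewrite fE Gauss_dvdpr //.
by rewrite coprimep_expl // (irreds_coprime QK PK QP).
Qed.

(** The source of every recursion in the file: summing the degree formula over
    a family [A] trades [size A] for the numbers of members divisible by each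
    prime power, and these live in lower degree. *)
Lemma sum_deg_irreds K n (A : seq {poly F}) :
  {in A, forall f, good f /\ deg f = n} -> (n <= K)%N ->
  (n * size A = \sum_(Q <- irreds K) \sum_(1 <= j < K.+1)
     deg Q * size [seq f <- A | (Q ^+ j %| f)%R])%N.
Proof.
move=> Ag nK; rewrite -sum1_size big_distrr /=.
transitivity (\sum_(f <- A) \sum_(Q <- irreds K) \sum_(1 <= j < K.+1)
     deg Q * (Q ^+ j %| f)%R)%N.
  rewrite !big_seq; apply: eq_bigr => f /Ag[fg fn].
  rewrite muln1 -{1}fn -(deg_sum_irreds (K := K)) ?fn //.
  by apply: eq_bigr => Q _; rewrite big_distrr.
rewrite exchange_big; apply: eq_bigr => Q _.
rewrite exchange_big; apply: eq_bigr => j _.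
rewrite -big_distrr /= size_filter -sum1_count [in RHS]big_mkcond /=.
by congr (_ * _)%N; apply: eq_bigr => f _; case: (_ %| _).
Qed.

(** The von Mangoldt function summed over degree [e], with a weight [w] on prime
    powers. *)
Definition Lam K (w : {poly F} -> nat -> nat) (e : nat) : nat :=
  (\sum_(Q <- irreds K) \sum_(1 <= j < K.+1)
     if j * deg Q == e then deg Q * w Q j else 0)%N.

Lemma leq_Lam K w w' e :
  (forall Q j, Q \in irreds K -> (0 < j)%N -> j * deg Q = e ->
     w Q j <= w' Q j)%N ->
  (Lam K w e <= Lam K w' e)%N.
Proof.
move=> ww'; rewrite /Lam !big_seq; apply: leq_sum => Q QK.
rewrite !big_nat; apply: leq_sum => j /andP[j0 _].
by case: eqP => // jQ; rewrite leq_mul2l ww' ?orbT.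
Qed.

Lemma Lam_sum K (I : Type) (r : seq I) (P : pred I) w e :
  Lam K (fun Q j => \sum_(i <- r | P i) w i Q j)%N e
  = (\sum_(i <- r | P i) Lam K (w i) e)%N.
Proof.
rewrite /Lam [RHS]exchange_big; apply: eq_bigr => Q _.
rewrite [RHS]exchange_big; apply: eq_bigr => j _.
by case: eqP => _; rewrite ?big_distrr // big1.
Qed.

Lemma sum_irreds_Lam K d (G : {poly F} -> nat -> nat -> nat) :
  (\sum_(Q <- irreds K) \sum_(1 <= j < K.+1)
     deg Q * (if j * deg Q <= d then G Q j (j * deg Q) else 0)
   = \sum_(1 <= e < d.+1) Lam K (fun Q j => G Q j e) e)%N.
Proof.
rewrite /Lam [RHS]exchange_big /= big_seq [RHS]big_seq; apply: eq_bigr => Q QK.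
rewrite [RHS]exchange_big /= !big_nat; apply: eq_bigr => j /andP[j0 _].
have jQ0 : (0 < j * deg Q)%N by case/irredsP: QK => *; rewrite muln_gt0 j0.
case: leqP => jd.
  rewrite (bigD1_seq (j * deg Q)%N) ?iota_uniq //=; last first.
    by rewrite mem_index_iota jQ0 ltnS.
  by rewrite eqxx big1 ?addn0 // => e /negbTE ne; rewrite eq_sym ne.
rewrite muln0 big_nat big1 // => e /andP[_ ed].
by rewrite gtn_eqF // (leq_trans ed).
Qed.

Definition Lam_const K c := Lam K (fun Q j => ((Q ^+ j).[0] == c) : nat).
Definition Lam_tot K := Lam K (fun _ _ => 1%N).

Lemma Lam_totE K e :
  Lam_tot K e = (\sum_(c : F | (c != 0)%R) Lam_const K c e)%N.
Proof.
rewrite -Lam_sum /Lam_tot /Lam !big_seq; apply: eq_bigr => Q QK.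
apply: eq_bigr => j _; case: eqP => // _; congr (_ * _)%N.
have [_ Qg _ _] := irredsP QK.
rewrite (bigD1 (Q ^+ j).[0]) ?good_const ?goodX //= eqxx big1 //.
by move=> c /andP[_ /negbTE]; rewrite eq_sym => ->.
Qed.

(** The degree formula summed over the [#|F| ^ n] polynomials of degree [n.+1]
    with constant term [c]: below the top degree, a prime power is completed by
    a cofactor whose constant term is forced but which is otherwise free. *)
Lemma Lam_const_rec K n c : c != 0 -> (n.+1 <= K)%N ->
  (n.+1 * #|F| ^ n
   = \sum_(1 <= e < n.+1) Lam_tot K e * #|F| ^ (n - e) + Lam_const K c n.+1)%N.
Proof.
move=> c0 nK; rewrite -(size_goods_const n c0) (@sum_deg_irreds K n.+1) //; last first.
  by move=> f; rewrite mem_filter mem_goods => /and3P[_ -> /eqP].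
transitivity (\sum_(Q <- irreds K) \sum_(1 <= j < K.+1)
     deg Q * (if j * deg Q <= n.+1 then
       size [seq g <- goods F (n.+1 - j * deg Q) | (g.[0] == c / (Q ^+ j).[0])%R]
       else 0))%N.
  rewrite !big_seq; apply: eq_bigr => Q /irredsP[_ Qg _ _].
  apply: eq_bigr => j _; congr (_ * _)%N.
  case: leqP => jQ.
    by rewrite -[in LHS](subnK jQ) (size_goods_dvd_const _ _ (goodX _ Qg)) ?degX.
  apply/eqP; rewrite size_eq0; apply/eqP/eqP; rewrite -[_ == _]negbK -has_filter.
  apply/hasPn => f; rewrite mem_filter mem_goods => /and3P[_ fg /eqP fn].
  apply/negP => /good_dvd_deg; rewrite goodX // degX // fn leqNgt jQ.
  by move=> /(_ fg isT).
rewrite (sum_irreds_Lam K n.+1 (fun Q j e =>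
  size [seq g <- goods F (n.+1 - e) | g.[0] == c / (Q ^+ j).[0]])).
rewrite big_nat_recr //=; congr (_ + _)%N.
  rewrite !big_nat; apply: eq_bigr => e /andP[e0 en].
  rewrite /Lam_tot /Lam big_distrl /= !big_seq; apply: eq_bigr => Q /irredsP[_ Qg _ _].
  rewrite big_distrl; apply: eq_bigr => j _; case: eqP => // _.
  by rewrite subSn // size_goods_const ?muln1 // mulf_neq0 ?invr_eq0 ?good_const ?goodX.
rewrite /Lam_const /Lam !big_seq; apply: eq_bigr => Q /irredsP[_ Qg _ _].
apply: eq_bigr => j _; case: eqP => // _; rewrite subnn size_goods0_const.
congr (_ * _)%N; congr nat_of_bool.
have Q0 := good_const (goodX j Qg).
by rewrite -(inj_eq (mulIf Q0)) divfK // mul1r eq_sym.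
Qed.

Lemma sum_units_geom n :
  (\sum_(c : F | (c != 0)%R) \sum_(0 <= i < n) #|F| ^ i).+1 = (#|F| ^ n)%N.
Proof.
have q0 : (0 < #|F|)%N by apply/card_gt0P; exists 0.
rewrite sum_nat_const (_ : #|_| = #|F|.-1); last first.
  by rewrite -(cardC1 (0 : F)); apply: eq_card => x; rewrite !inE.
by rewrite big_mkord -predn_exp prednK // expn_gt0 q0.
Qed.

(** The prime polynomial theorem in residue classes modulo 'X.  It is exact
    because the recursion [Lam_const_rec] involves the class of [c] only through
    its last term, so that all classes carry the same weight. *)
Lemma Lam_constE K n c : c != 0 -> (0 < n <= K)%N ->
  Lam_const K c n = (\sum_(0 <= i < n) #|F| ^ i)%N.
Proof.
elim/ltn_ind: n c => -[//|n] IH c c0 /andP[_ nK].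
have tot e : (0 < e < n.+1)%N -> (Lam_tot K e).+1 = (#|F| ^ e)%N.
  move=> /andP[e0 en]; rewrite Lam_totE.
  rewrite (eq_bigr (fun _ => \sum_(0 <= i < e) #|F| ^ i)%N) ?sum_units_geom //.
  by move=> d d0; rewrite IH // e0 (leq_trans (ltnW en)).
apply/eqP; rewrite -(eqn_add2l (\sum_(1 <= e < n.+1) Lam_tot K e * #|F| ^ (n - e))).
rewrite -Lam_const_rec //; apply/eqP.
have -> : (\sum_(0 <= i < n.+1) #|F| ^ i
   = \sum_(1 <= e < n.+1) #|F| ^ (n - e) + #|F| ^ n)%N.
  rewrite big_nat_recr //=; congr (_ + _)%N.
  by rewrite big_nat_rev big_add1; apply: eq_bigr => i _; rewrite add0n.
rewrite addnA -big_split /= (eq_big_nat _ _ (F2 := fun _ => #|F| ^ n)%N).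
  by rewrite sum_nat_const_nat subn1 mulSnr.
move=> e e_n; rewrite -mulSnr tot // -expnD subnKC //.
by case/andP: e_n.
Qed.

Lemma Lam_tot_lt K n : (0 < n <= K)%N -> (Lam_tot K n < #|F| ^ n)%N.
Proof.
move=> nK; rewrite Lam_totE.
rewrite (eq_bigr (fun _ => \sum_(0 <= i < n) #|F| ^ i)%N) ?sum_units_geom //.
by move=> d d0; rewrite Lam_constE.
Qed.

End PrimePowers.

(** * Twisted reciprocals and norms *)

Section TwistedReciprocal.
Variables (F : finFieldType) (phi : {rmorphism F -> F}).
Hypothesis phiK : involutive phi.
Implicit Types (f g h s p Q : {poly F}) (c : F).

(** Taking [phi] to be the identity or the half Frobenius gives the two
    reciprocals of interest; their common theory rests on [phi] being an
    involutive ring morphism. *)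
Definition recip f : {poly F} :=
  (map_poly phi f).[0]^-1 *: poly_rev (map_poly phi f).

(** The reversal relative to a fixed formal degree [n]: additive in [f], which
    the reversal relative to the true degree is not. *)
Definition rev_upto n f : {poly F} := \poly_(i < n.+1) f`_(n - i).

Lemma recipE f : good f ->
  recip f = (phi f.[0])^-1 *: rev_upto (deg f) (map_poly phi f).
Proof.
move=> fg; rewrite /recip -{1}(rmorph0 phi) horner_map /poly_rev /rev_upto.
by rewrite size_map_poly size_good.
Qed.

Lemma rev_uptoMX n f : rev_upto n.+1 (f * 'X) = rev_upto n f.
Proof.
apply/polyP => i; rewrite !coef_poly coefMX ltnS.
case: (ltngtP i n.+1) => [|ni|->].
- by rewrite ltnS => ni; rewrite subSn.
- by [].
- by rewrite subnn.
Qed.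

Lemma rev_uptoD n f g : rev_upto n (f + g) = rev_upto n f + rev_upto n g.
Proof.
by apply/polyP => i; rewrite coefD !coef_poly; case: ifP; rewrite ?coefD ?addr0.
Qed.

Lemma rev_uptoC n c f : rev_upto n (c%:P * f) = c%:P * rev_upto n f.
Proof.
by apply/polyP => i; rewrite coefCM !coef_poly; case: ifP; rewrite ?coefCM ?mulr0.
Qed.

Lemma rev_upto_widen k n f : (size f <= n.+1)%N ->
  rev_upto (k + n) f = 'X^k * rev_upto n f.
Proof.
move=> fn; apply/polyP => i; rewrite coefXnM !coef_poly.
case: (ltnP i k) => ik.
  have -> : f`_(k + n - i) = 0; last by rewrite if_same.
  apply: nth_default; apply: leq_trans fn _.
  by move: ik; lia.
rewrite !ltnS leq_subLR; case: ifP => // ikn; congr (_`_ _).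
by rewrite subnBA // addnC.
Qed.

Lemma rev_uptoM n m f g : (size f <= n.+1)%N -> (size g <= m.+1)%N ->
  rev_upto (n + m) (f * g) = rev_upto n f * rev_upto m g.
Proof.
elim: n f => [|n IHn] f fn gm.
  rewrite (size1_polyC fn) rev_uptoC; congr (_ * _).
  by apply/polyP => -[|i]; rewrite coef_poly !coefC.
have [h [c fE]] := poly_split f.
have hn : (size h <= n.+1)%N.
  move: fn; rewrite fE size_MXaddC; case: ifP => [/andP[/eqP-> _] _|_]; last by [].
  by rewrite size_poly0.
rewrite fE mulrDl -mulrA -commr_polyX mulrA addSn rev_uptoD rev_uptoMX.
rewrite rev_uptoD rev_uptoMX mulrDl IHn // rev_uptoC -addSn rev_upto_widen //.
rewrite mulrA; congr (_ + _ * _); apply/polyP => i.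
rewrite coefCM coefXn coef_poly coefC subn_eq0 ltnS.
by case: (ltngtP i n.+1); rewrite ?mulr1 ?mulr0.
Qed.

Lemma coef_recip f i : good f -> (i <= deg f)%N ->
  (recip f)`_i = (phi f.[0])^-1 * phi f`_(deg f - i).
Proof.
by move=> fg i_f; rewrite recipE // coefZ coef_poly ltnS i_f coef_map.
Qed.

Lemma coef_deg f : good f -> f`_(deg f) = 1.
Proof. by move=> /good_monic; rewrite monicE lead_coefE => /eqP. Qed.

Lemma phi_const_neq0 f : good f -> phi f.[0] != 0.
Proof. by move=> fg; rewrite fmorph_eq0 good_const. Qed.

Lemma recip_good_size f : good f -> good (recip f) /\ size (recip f) = size f.
Proof.
move=> fg; have f0 := phi_const_neq0 fg.
have lc : (recip f)`_(deg f) = 1.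
  by rewrite coef_recip // subnn -horner_coef0 mulVf.
have sz : size (recip f) = size f.
  apply/eqP; rewrite eqn_leq; apply/andP; split.
    rewrite recipE // size_scale ?invr_eq0 // size_good //; exact: size_poly.
  rewrite size_good // ltnNge; apply/negP => /(nth_default 0).
  by rewrite lc => /eqP; rewrite oner_eq0.
split=> //; apply/andP; split.
  by rewrite monicE lead_coefE sz; apply/eqP.
by rewrite horner_coef0 coef_recip // subn0 coef_deg // rmorph1 mulr1 invr_eq0.
Qed.

Lemma recip_good f : good f -> good (recip f).
Proof. by move=> /recip_good_size[]. Qed.

Lemma deg_recip f : good f -> deg (recip f) = deg f.
Proof. by rewrite /deg => /recip_good_size[_ ->]. Qed.

Lemma recip_const f : good f -> (recip f).[0] = (phi f.[0])^-1.
Proof.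
by move=> fg; rewrite horner_coef0 coef_recip // subn0 coef_deg // rmorph1 mulr1.
Qed.

Lemma poly_eq_deg f g : good f -> good g -> deg f = deg g ->
  (forall i, (i <= deg f)%N -> f`_i = g`_i) -> f = g.
Proof.
move=> fg gg fgd E; apply/polyP => i; case: (leqP i (deg f)) => [|fi]; first exact: E.
by rewrite !nth_default // ?size_good // -fgd.
Qed.

Lemma recipK f : good f -> recip (recip f) = f.
Proof.
move=> fg; apply: poly_eq_deg; rewrite ?recip_good ?deg_recip ?recip_good //.
move=> i i_f; rewrite coef_recip ?recip_good ?deg_recip //.
rewrite recip_const // coef_recip ?leq_subr // subKn //.
by rewrite rmorphM fmorphV !phiK invrK mulrA mulfV ?mul1r ?good_const.
Qed.

Lemma recipM f g : good f -> good g -> recip (f * g) = recip f * recip g.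
Proof.
move=> fg gg; rewrite !recipE ?goodM // hornerM degM // [map_poly _ (f * g)]rmorphM /=.
rewrite rev_uptoM ?size_map_poly ?size_good //.
by rewrite rmorphM invfM -scalerAl -scalerAr scalerA.
Qed.

Lemma recipX f j : good f -> recip (f ^+ j) = recip f ^+ j.
Proof.
move=> fg; elim: j => [|j IH]; last by rewrite !exprS recipM ?goodX // IH.
apply/eqP; rewrite !expr0 -deg_eq0 ?recip_good ?good1 //.
by rewrite deg_recip ?good1 // deg1.
Qed.

Definition norm g := g * recip g.

Lemma norm_good g : good g -> good (norm g).
Proof. by move=> gg; rewrite goodM ?recip_good. Qed.

Lemma deg_norm g : good g -> deg (norm g) = (deg g).*2.
Proof. by move=> gg; rewrite degM ?recip_good // deg_recip // addnn. Qed.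

Lemma normM g h : good g -> good h -> norm (g * h) = norm g * norm h.
Proof. by move=> gg hg; rewrite /norm recipM // mulrACA. Qed.

Lemma norm_recip g : good g -> norm (recip g) = norm g.
Proof. by move=> gg; rewrite /norm recipK // mulrC. Qed.

Lemma recip_norm g : good g -> recip (norm g) = norm g.
Proof. by move=> gg; rewrite /norm recipM ?recip_good // recipK // mulrC. Qed.

Lemma norm_const g : good g -> (norm g).[0] = g.[0] / phi g.[0].
Proof. by move=> gg; rewrite hornerM recip_const. Qed.

(** If [Q] divides [recip g] rather than [g], exchange the two: this leaves the
    norm unchanged. *)
Lemma dvd_norm Q g : irreducible_poly Q -> good Q -> good g -> Q %| norm g ->
  exists2 h, good h & norm g = norm (Q * h).
Proof.
move=> Qi Qg gg; case: (boolP (Q %| g)) => [/(good_dvdP Qg gg)[h hg ->] _|nQ].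
  by exists h.
rewrite Gauss_dvdpr ?irreducible_poly_coprime //.
case/(good_dvdP Qg (recip_good gg)) => h hg hE.
by exists h => //; rewrite -hE norm_recip.
Qed.

(** The power of [norm Q] forced to divide a norm divisible by [Q ^+ j]:
    a self-reciprocal [Q] has [norm Q = Q ^+ 2], which accounts for [Q] twice,
    whereas otherwise [Q] and [recip Q] are coprime. *)
Definition forced Q j := if recip Q == Q then uphalf j else j.

Lemma dvd_exp_norm Q g j : irreducible_poly Q -> good Q -> good g ->
  Q ^+ j %| norm g ->
  exists2 h, good h & norm g = norm (Q ^+ forced Q j * h).
Proof.
move=> Qi Qg; have Q0 := good_neq0 Qg; rewrite /forced.
case: (eqVneq (recip Q) Q) => Qsym.
  elim/ltn_ind: j g => -[|[|j]] IH g gg Qjg.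
  - by exists g => //; rewrite expr0 mul1r.
  - by rewrite expr1 in Qjg *; apply: dvd_norm.
  have [|h hg gE] := dvd_norm Qi Qg gg.
    by apply: dvdp_trans Qjg; rewrite exprS dvdp_mulr.
  have : Q ^+ j %| norm h.
    by move: Qjg; rewrite gE normM // {1}/norm Qsym !exprS -!mulrA !dvdp_mul2l.
  case/IH=> // h' h'g hE; exists h' => //.
  by rewrite gE normM // hE -normM ?goodM ?goodX // mulrA -exprS.
elim: j g => [|j IH] g gg Qjg; first by exists g => //; rewrite expr0 mul1r.
have [|h hg gE] := dvd_norm Qi Qg gg.
  by apply: dvdp_trans Qjg; rewrite exprS dvdp_mulr.
have : Q ^+ j %| norm h.
  move: Qjg; rewrite gE normM // {1}/norm exprS -!mulrA dvdp_mul2l //.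
  rewrite Gauss_dvdpr // coprimep_expl // irred_coprime ?recip_good //.
    by rewrite deg_recip.
  by rewrite eq_sym.
case/IH=> // h' h'g hE; exists h' => //.
by rewrite gE normM // hE -normM ?goodM ?goodX // mulrA -exprS.
Qed.

Definition norms d : seq {poly F} := undup [seq norm g | g <- goods F d].

Lemma mem_normsP d s :
  reflect (exists g, [/\ good g, deg g = d & s = norm g]) (s \in norms d).
Proof.
rewrite mem_undup; apply: (iffP mapP) => [[g]|[g [gg gd ->]]].
  by rewrite mem_goods => /andP[gg /eqP gd] ->; exists g.
by exists g; rewrite // mem_goods gg gd /=.
Qed.

Lemma size_norms d : (size (norms d) <= #|F| ^ d)%N.
Proof.
by apply: leq_trans (size_undup _) _; rewrite size_map size_goods.
Qed.

Definition norm_count (P : pred F) d := size [seq s <- norms d | P s.[0]].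

Lemma sum_uphalf (H : nat -> nat) d :
  (\sum_(1 <= j < d.*2.+1) H (uphalf j) = (\sum_(1 <= j < d.+1) H j).*2)%N.
Proof.
elim: d => [|d IH]; first by rewrite !big_geq.
rewrite doubleS 2?big_nat_recr //= IH [in RHS]big_nat_recr //= doubleD.
by rewrite uphalf_double doubleK -[(H d.+1).*2]addnn addnA.
Qed.

(** A norm of degree [d.*2] is spread over its prime powers [Q ^+ j], and each of
    these forces a factor [norm (Q ^+ forced Q j)] whose cofactor is a norm again.
    For [Q] not self-reciprocal, a prime power of degree [e] thus removes [2 * e]
    from the degree of the norm: hence the [d.*2] on the left, where the identity
    for all polynomials of degree [d] has [d], and hence the sparsity of norms.
    For a self-reciprocal [Q] the values of [forced Q] are each taken twice,
    whence the extra factor. *)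
Lemma norm_count_rec (P : pred F) d :
  (d.*2 * norm_count P d <= \sum_(1 <= e < d.+1) Lam d.*2 (fun Q j =>
     (recip Q == Q).+1 *
     norm_count (fun c => P ((norm (Q ^+ j)).[0] * c)%R) (d - e)) e)%N.
Proof.
pose cnt := fun Q j => if (j * deg Q <= d)%N then
  norm_count (fun c => P ((norm (Q ^+ j)).[0] * c)%R) (d - j * deg Q) else 0%N.
rewrite (@sum_deg_irreds _ d.*2 d.*2) //; last first.
  move=> s; rewrite mem_filter => /andP[_ /mem_normsP[g [gg gd ->]]].
  by rewrite norm_good // deg_norm // gd.
rewrite -(sum_irreds_Lam d.*2 d (fun Q j e => (recip Q == Q).+1 *
     norm_count (fun c => P ((norm (Q ^+ j)).[0] * c)%R) (d - e))%N).
rewrite !big_seq; apply: leq_sum => Q /irredsP[Qi Qg _ _].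
apply: (@leq_trans (\sum_(1 <= j < d.*2.+1) deg Q * cnt Q (forced Q j))%N).
  apply: leq_sum => j _; rewrite leq_mul2l; apply/orP; right.
  rewrite /cnt; set r := forced Q j; set A := [seq _ <- _ | _].
  have AP s : s \in A -> exists2 h, good h &
      [/\ s = norm (Q ^+ r * h), P s.[0] & d = (r * deg Q + deg h)%N].
    rewrite mem_filter mem_filter => /and3P[Qs Ps /mem_normsP[g [gg gd sE]]].
    rewrite sE in Qs; have [h hg gE] := dvd_exp_norm Qi Qg gg Qs.
    exists h => //; rewrite sE in Ps *; split=> //.
    apply: double_inj; rewrite -gd -deg_norm // gE.
    by rewrite deg_norm ?goodM ?goodX // degM ?goodX // degX.
  have Au : uniq A by rewrite !filter_uniq // undup_uniq.
  case: (leqP (r * deg Q) d) => rd.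
    rewrite /norm_count; apply: (leq_size_cofactor (p := norm (Q ^+ r)) Au) => s.
    case/AP=> h hg [sE Ps dE]; exists (norm h); last by rewrite sE normM // goodX.
    rewrite mem_filter -hornerM -normM ?goodX // -sE Ps /=.
    by apply/mem_normsP; exists h; rewrite dE addKn.
  rewrite leqn0 size_eq0; apply/eqP; case E: A => [//|s A'].
  have [|h _ [_ _ dE]] := AP s; first by rewrite E mem_head.
  by rewrite dE ltnNge leq_addr in rd.
rewrite /forced; case: eqP => Qsym; last first.
  apply: leq_sum => j _; rewrite leq_mul2l /cnt.
  by case: ifP => _; rewrite ?mul1n ?leqnn orbT //.
have -> : (\sum_(1 <= j < d.*2.+1) deg Q * cnt Q (uphalf j)
   = 2 * \sum_(1 <= j < d.+1) deg Q * cnt Q j)%N.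
  by rewrite -!big_distrr /= (sum_uphalf (cnt Q)) -mul2n mulnCA.
rewrite [leqRHS](eq_bigr (fun j => 2 * (deg Q * cnt Q j))%N); last first.
  by move=> j _; rewrite /cnt; case: ifP; rewrite ?muln0 // mulnCA.
rewrite -[leqRHS]big_distrr leq_mul2l /=.
rewrite [leqRHS](big_cat_nat (n := d.+1)) ?ltnS -?addnn ?leq_addr //=.
Qed.

End TwistedReciprocal.

(** * Self-reciprocal polynomials, and recursions for norms *)

Section Counting.
Variables (F : finFieldType) (phi : {rmorphism F -> F}).
Hypothesis phiK : involutive phi.
Implicit Types (f g h s p Q : {poly F}) (c b : F).

Local Notation recip := (recip phi).
Local Notation norm := (norm phi).
Local Notation norms := (norms phi).
Local Notation norm_count := (norm_count phi).

Definition self_recip f := recip f == f.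

(** The upper half of the coefficients is the reflection of the lower half. *)
Lemma self_recip_eq f g : good f -> good g -> self_recip f -> self_recip g ->
  deg f = deg g -> (forall i, (i <= (deg f)./2)%N -> f`_i = g`_i) -> f = g.
Proof.
move=> fg gg /eqP fs /eqP gs fgd E; apply: poly_eq_deg => // i i_f.
case: (leqP i (deg f)./2) => [|hi]; first exact: E.
rewrite -{1}fs -gs !coef_recip -?fgd // !horner_coef0 !E //.
rewrite leq_subLR -[leqLHS]odd_double_half -addnn addnA leq_add2r.
by case: (odd _); rewrite ?add1n // ltnW.
Qed.

Lemma size_le_card (T : eqType) (U : finType) (r : seq T) (v : T -> U) :
  uniq r -> {in r &, injective v} -> (size r <= #|U|)%N.
Proof.
move=> ru vi; rewrite -(size_map v) -(card_uniqP _) ?map_inj_in_uniq //.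
exact: max_card.
Qed.

Lemma size_self_recip e :
  (size [seq f <- goods F e | self_recip f] <= #|F| ^ (e./2).+1)%N.
Proof.
pose v f := [ffun i : 'I_(e./2).+1 => f`_i].
rewrite -[in leqRHS](card_ord (e./2).+1) -card_ffun.
apply: (size_le_card (v := v)); first by rewrite filter_uniq ?goods_uniq.
move=> f g; rewrite mem_filter mem_goods => /and3P[fs fg /eqP fe].
rewrite mem_filter mem_goods => /and3P[gs gg /eqP ge] vfg.
apply: self_recip_eq; rewrite ?fe ?ge // => i ie.
by have /ffunP/(_ (Ordinal (ie : i < (e./2).+1)%N)) := vfg; rewrite !ffunE.
Qed.

(** Powers of self-reciprocal primes are themselves self-reciprocal, so it
    suffices to keep, in the degree formula summed over self-reciprocal [f], the
    one prime power equal to [f]. *)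
Lemma Lam_self_recip K e : (e <= K)%N ->
  (Lam K (fun Q _ => self_recip Q) e <= e * #|F| ^ (e./2).+1)%N.
Proof.
move=> eK; set A := [seq f <- goods F e | self_recip f].
apply: (@leq_trans (e * size A)); last by rewrite leq_mul2l size_self_recip orbT.
rewrite (sum_deg_irreds (K := K)) //; last first.
  by move=> f; rewrite mem_filter mem_goods => /and3P[_ -> /eqP].
rewrite /Lam !big_seq; apply: leq_sum => Q /irredsP[_ Qg _ _].
apply: leq_sum => j _; case: eqP => // jQ.
case: (boolP (self_recip Q)) => [/eqP Qs|_]; last by rewrite muln0.
rewrite leq_mul2l size_filter -has_count; apply/orP; right; apply/hasP.
exists (Q ^+ j); rewrite ?dvdpp // mem_filter mem_goods goodX // degX // jQ eqxx.
by rewrite /self_recip recipX // Qs eqxx.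
Qed.

Definition norm_num d := size (norms d).

Lemma norm_num_le d : (norm_num d <= #|F| ^ d)%N.
Proof. exact: size_norms. Qed.

Lemma Lam_mull K a (w : {poly F} -> nat -> nat) e :
  Lam K (fun Q j => a * w Q j)%N e = (a * Lam K w e)%N.
Proof.
rewrite /Lam big_distrr; apply: eq_bigr => Q _.
rewrite big_distrr; apply: eq_bigr => j _ /=.
by case: eqP; rewrite ?muln0 // mulnCA.
Qed.

Lemma Lam_add K (w w' : {poly F} -> nat -> nat) e :
  Lam K (fun Q j => w Q j + w' Q j)%N e = (Lam K w e + Lam K w' e)%N.
Proof.
rewrite /Lam -big_split; apply: eq_bigr => Q _ /=.
rewrite -big_split; apply: eq_bigr => j _ /=.
by case: eqP; rewrite // mulnDr.
Qed.

(** The bracket is [#|F| ^ e] up to an error of smaller order, so that the density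
    of norms behaves like the coefficients of [(1 - w) ^ (-1/2)]. *)
Lemma norm_num_rec d :
  (d.*2 * norm_num d <= \sum_(1 <= e < d.+1)
     norm_num (d - e) * (#|F| ^ e + e * #|F| ^ (e./2).+1))%N.
Proof.
have cntT (P : pred F) k : (forall c, P c) -> norm_count P k = norm_num k.
  by move=> PT; congr size; apply/all_filterP/allP => s _.
rewrite -(cntT predT) //; apply: leq_trans (norm_count_rec phiK _ _) _.
rewrite !big_nat; apply: leq_sum => e /andP[e0]; rewrite ltnS => ed.
have eK : (e <= d.*2)%N by rewrite -addnn (leq_trans ed) // leq_addr.
apply: (@leq_trans (norm_num (d - e) *
    (Lam_tot F d.*2 e + Lam d.*2 (fun Q _ => self_recip Q) e))).
  rewrite -Lam_add -Lam_mull; apply: leq_Lam => Q j _ _ _.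
  by rewrite cntT // add1n mulnC.
rewrite leq_mul2l leq_add ?orbT ?Lam_self_recip //.
by rewrite ltnW // Lam_tot_lt // e0.
Qed.

(* The half Frobenius, whose reciprocals are the unitary ones. *)
Variable q0 : nat.
Hypothesis phiE : forall x, phi x = x ^+ q0.
Hypothesis card_F : #|F| = (q0 ^ 2)%N.

Lemma q0_gt1 : (1 < q0)%N.
Proof.
by have := finNzRing_gt1 F; rewrite card_F; case: q0 => [|[|?]].
Qed.

Lemma card_ratio t : (#|[pred c : F | (c != 0)%R && (c / phi c == t)%R]| < q0)%N.
Proof.
have q1 := q0_gt1; set A := [pred _ | _].
pose p : {poly F} := t *: 'X^(q0.-1) - 1.
have p0 : p != 0.
  apply/negP => /eqP/(congr1 (fun r => r.[0])).
  rewrite !hornerE expr0n -subn1 subn_eq0 leqNgt q1 mulr0 sub0r => /eqP.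
  by rewrite oppr_eq0 oner_eq0.
have psz : (size p <= q0)%N.
  rewrite (leq_trans (size_polyD _ _)) // geq_max size_polyN size_poly1 (ltnW q1).
  by rewrite (leq_trans (size_scale_leq _ _)) // size_polyXn prednK // ltnW.
rewrite cardE (leq_trans _ psz) // max_poly_roots ?enum_uniq //.
apply/allP => c; rewrite mem_enum inE => /andP[c0 /eqP tE].
rewrite rootE !hornerE -tE phiE subr_eq0.
by case: q0 q1 => // k _; rewrite exprS /= invfM mulrA mulfV // mul1r mulVf ?expf_neq0.
Qed.

(** The map sending [c] to [c / phi c] has fibres of size at most [q0 - 1], and
    prime powers are equidistributed over constant terms; as
    [#|F| - 1 = (q0 - 1) * (q0 + 1)], a prescribed ratio saves a factor [q0]. *)
Lemma Lam_ratio K e (t b : F) : t != 0 -> (0 < e <= K)%N ->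
  (Lam K (fun Q j => ((norm (Q ^+ j)).[0] * t == b)%R : nat) e <= q0 ^ (e.*2.-1))%N.
Proof.
move=> t0 eK; have q1 := q0_gt1; have [e0 _] := andP eK.
pose A := [pred c : F | (c != 0) && (c / phi c == b / t)].
apply: (@leq_trans (\sum_(c in A) Lam_const K c e)).
  rewrite /Lam_const -Lam_sum; apply: leq_Lam => Q j /irredsP[_ Qg _ _] _ _.
  case: eqP => // E; rewrite (bigD1 (Q ^+ j).[0]) ?eqxx ?leq_addr //=.
  by rewrite inE good_const ?goodX //= -norm_const ?goodX // -E mulfK.
rewrite (eq_bigr (fun=> \sum_(0 <= i < e) #|F| ^ i)%N); last first.
  by move=> c /andP[c0 _]; rewrite Lam_constE.
rewrite sum_nat_const -(@leq_pmul2l q0.+1) //.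
apply: (@leq_trans (q0.+1 * (q0.-1 * \sum_(0 <= i < e) #|F| ^ i))).
  rewrite leq_mul2l leq_mul2r; apply/orP; right; apply/orP; right.
  by rewrite -ltnS prednK ?card_ratio // ltnW.
rewrite mulnA (_ : q0.+1 * q0.-1 = #|F|.-1)%N; last first.
  by rewrite card_F -mulnn; case: q0 q1 => // k _; lia.
rewrite big_mkord -predn_exp card_F -expnM mul2n (leq_trans (leq_pred _)) //.
have -> : (q0 ^ e.*2 = q0 * q0 ^ e.*2.-1)%N.
  by rewrite -expnS prednK // double_gt0.
by rewrite leq_mul2r leqnSn orbT.
Qed.

(** Prescribing the constant term [b] divides the bound for all norms by about
    [q0].  The sum on the right is over unrestricted norms because the
    constraint can be carried by the prime power alone, whatever the cofactor. *)
Lemma norm_count_const d b :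
  (d * norm_count (pred1 b) d <= \sum_(1 <= e < d.+1)
     norm_num (d - e) * q0 ^ (e.*2.-1))%N.
Proof.
rewrite -(@leq_pmul2l 2) // mulnA mul2n.
apply: leq_trans (norm_count_rec phiK _ _) _.
rewrite big_distrr /= !big_nat; apply: leq_sum => e /andP[e0]; rewrite ltnS => ed.
have eK : (0 < e <= d.*2)%N.
  by rewrite e0 -addnn (leq_trans ed) // leq_addr.
apply: (@leq_trans (2 * \sum_(s <- norms (d - e))
    Lam d.*2 (fun Q j => ((norm (Q ^+ j)).[0] * s.[0] == b)%R : nat) e)).
  rewrite -Lam_sum -Lam_mull; apply: leq_Lam => Q j _ _ _.
  rewrite leq_mul //; first by rewrite ltnS leq_b1.
  rewrite /norm_count size_filter -sum1_count big_mkcond /=.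
  by apply: leq_sum => s _; case: (_ == b).
rewrite leq_mul2l /= /norm_num -sum1_size big_distrl /= !big_seq.
apply: leq_sum => s /mem_normsP[g [gg _ ->]].
by rewrite mul1n Lam_ratio // good_const ?norm_good.
Qed.

Lemma card_fixed_twist (t : F) : (#|[pred x : F | (x == t * phi x)%R]| <= q0)%N.
Proof.
have q1 := q0_gt1; set A := [pred _ | _].
pose p : {poly F} := 'X - t *: 'X^q0.
have p0 : p != 0.
  apply/negP => /eqP/(congr1 (fun r : {poly F} => r`_1)).
  rewrite coefB coefX coefZ coefXn coef0 (ltn_eqF q1) mulr0 subr0 => /eqP.
  by rewrite oner_eq0.
have psz : (size p <= q0.+1)%N.
  rewrite (leq_trans (size_polyD _ _)) // geq_max size_polyN size_polyX ltnS (ltnW q1).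
  by rewrite (leq_trans (size_scale_leq _ _)) // size_polyXn.
rewrite cardE -ltnS (leq_trans _ psz) // max_poly_roots ?enum_uniq //.
apply/allP => c; rewrite mem_enum inE => /eqP cE.
by rewrite rootE !hornerE -phiE -cE subrr.
Qed.

(** The constant term is prescribed and the lower half of the coefficients
    determines the rest; in even degree, the middle coefficient moreover
    satisfies an equation with at most [q0] solutions. *)
Lemma size_self_recip_const k b : (0 < k)%N ->
  (size [seq f <- goods F k | self_recip f & f.[0] == b] <= q0 ^ k.-1)%N.
Proof.
move=> k0; set A := [seq _ <- _ | _]; have q1 := q0_gt1.
pose l := (k.-1)./2; have Au : uniq A by rewrite filter_uniq ?goods_uniq.
have AP f : f \in A -> [/\ good f, deg f = k, self_recip f & f.[0] = b].
  by rewrite mem_filter mem_goods => /andP[/andP[-> /eqP ->] /andP[-> /eqP]].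
pose v f := [ffun i : 'I_l => f`_i.+1].
have AE f g : f \in A -> g \in A -> v f = v g ->
    (~~ odd k -> f`_l.+1 = g`_l.+1) -> f = g.
  move=> /AP[fg fk fs fb] /AP[gg gk gs gb] /ffunP vE mid.
  apply: self_recip_eq; rewrite ?fk ?gk // => -[_|i ik].
    by rewrite -!horner_coef0 fb gb.
  case: (ltnP i l) => il; first by have := vE (Ordinal il); rewrite !ffunE.
  have -> : i = l by move: ik il; rewrite /l; lia.
  by apply: mid; move: ik il; rewrite /l; lia.
have q2l : (#|{ffun 'I_l -> F}| = q0 ^ l.*2)%N.
  by rewrite card_ffun card_ord card_F -expnM mul2n.
case: (boolP (odd k)) => kodd.
  rewrite (_ : k.-1 = l.*2)%N; last by move: kodd; rewrite /l; lia.
  rewrite -q2l; apply: (size_le_card (v := v)) => // f g fA gA vfg.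
  by apply: AE => //; rewrite kodd.
rewrite (_ : k.-1 = l.*2.+1)%N; last by move: kodd k0; rewrite /l; lia.
pose T := [pred x : F | x == (phi b)^-1 * phi x].
have mT f : f \in A -> f`_l.+1 \in T.
  move=> /AP[fg fk /eqP fs fb]; have lk : (l.+1 + l.+1 = k)%N.
    by move: kodd k0; rewrite /l; lia.
  rewrite inE -{1}fs coef_recip // fk -?lk ?leq_addr // addKn fb //.
pose w f := (v f, f`_l.+1).
have -> : size A = size (map w A) by rewrite size_map.
have wu : uniq (map w A).
  rewrite map_inj_in_uniq // => f g fA gA [vfg mid].
  by apply: AE => // _.
rewrite -(card_uniqP wu); apply: (@leq_trans #|[predX {: {ffun 'I_l -> F}} & T]|).
  apply/subset_leq_card/subsetP => z /mapP[f fA ->].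
  by rewrite inE /= mT.
rewrite cardX q2l expnSr leq_mul2l card_fixed_twist orbT //.
Qed.

End Counting.

(** * Factorisations as a norm times a cofactor *)

Section Factorisations.
Variables (F : finFieldType) (phi : {rmorphism F -> F}).
Hypothesis phiK : involutive phi.
Implicit Types (f g h s : {poly F}) (a c : F).

Definition self_recips k c :=
  [seq f <- goods F k | self_recip phi f & f.[0] == c].

Lemma self_recips_uniq k c : uniq (self_recips k c).
Proof. by rewrite filter_uniq ?goods_uniq. Qed.

Lemma mem_self_recips k c f : (f \in self_recips k c) =
  [&& good f, deg f == k, self_recip phi f & f.[0] == c].
Proof. by rewrite mem_filter mem_goods andbC -andbA. Qed.

(** An upper bound for the number of self-reciprocal [f] of degree [n] and
    constant term [a] with cofactor of degree [k]: the number of possible pairs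
    of a norm and a cofactor. *)
Definition factorisations n a k : nat :=
  if (k <= n)%N && ~~ odd (n - k) then
    (\sum_(s <- norms phi (n - k)./2) size (self_recips k (a / s.[0])))%N
  else 0%N.

(** Norms are self-reciprocal, hence so is the cofactor of a norm in a
    self-reciprocal polynomial: cancel the norm in [recip f = f]. *)
Lemma size_le_factorisations n a M (X : seq {poly F}) : uniq X ->
  {in X, forall f, f \in self_recips n a /\ exists g h,
     [/\ good g, h \is monic, (deg h <= M)%N & f = norm phi g * h]} ->
  (size X <= \sum_(0 <= k < M.+1) factorisations n a k)%N.
Proof.
move=> Xu XP.
pose L k := if (k <= n)%N && ~~ odd (n - k) then
  [seq s * h | s <- norms phi (n - k)./2, h <- self_recips k (a / s.[0])] else [::].
have -> : (\sum_(0 <= k < M.+1) factorisations n a k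
    = size (flatten [seq L k | k <- iota 0 M.+1]))%N.
  rewrite size_flatten sumnE !big_map /index_iota subn0; apply: eq_bigr => k _.
  rewrite /factorisations /L; case: ifP => // _.
  by rewrite size_allpairs_dep sumnE big_map.
apply: uniq_leq_size => // f /XP[]; rewrite mem_self_recips.
case/and4P=> fg /eqP fn /eqP fs /eqP fa [g [h [gg hm hM fE]]].
have Ng := norm_good phi gg.
have hg : good h by rewrite -(goodM h Ng) -fE.
have nE : n = ((deg g).*2 + deg h)%N by rewrite -fn fE degM // deg_norm.
have hs : self_recip phi h.
  move: fs; rewrite fE recipM // recip_norm //.
  by move/(mulfI (good_neq0 Ng)) => hs; apply/eqP.
apply/flatten_mapP; exists (deg h); first by rewrite mem_iota ltnS.
rewrite /L nE leq_addl addnK odd_double doubleK /= fE.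
apply/allpairsPdep; exists (norm phi g), h; split=> //.
  by apply/mem_normsP; exists g.
rewrite mem_self_recips hg eqxx hs /= -fa fE hornerM mulrC mulKf //.
exact: good_const.
Qed.

End Factorisations.

Section OrdinaryReciprocal.
Variables (F : finFieldType) (phi : {rmorphism F -> F}).
Hypothesis phi_id : forall x, phi x = x.
Implicit Types (f g h s : {poly F}) (a c : F).

Local Notation self_recips := (self_recips phi).

Lemma rev_uptoXn n i : (i <= n)%N -> rev_upto n ('X^i : {poly F}) = 'X^(n - i).
Proof.
move=> i_n; apply/polyP => j; rewrite coef_poly !coefXn ltnS.
case: leqP => jn; last by rewrite (gtn_eqF _) // (leq_ltn_trans _ jn) ?leq_subr.
by congr (_%:R); congr nat_of_bool; lia.
Qed.

Lemma self_recip_rev a k f : a ^+ 2 = 1 -> good f -> deg f = k -> f.[0] = a ->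
  self_recip phi f = (rev_upto k f == a *: f).
Proof.
move=> a1 fg fk fa; rewrite /self_recip recipE // fk fa phi_id.
have -> : map_poly phi f = f by rewrite (eq_map_poly phi_id) map_poly_id.
have a0 : a != 0 by rewrite -fa good_const.
have aV : a^-1 = a by apply: (mulfI a0); rewrite mulfV // -expr2.
rewrite aV; apply/eqP/eqP => [E|->].
  by rewrite -{2}E scalerA -expr2 a1 scale1r.
by rewrite scalerA -expr2 a1 scale1r.
Qed.

Lemma self_recips_mono1 a k (G : {poly F}) : a ^+ 2 = 1 ->
  (forall i, (k < i)%N -> G`_i = 0) -> G`_k = 1 -> G`_0 = a ->
  rev_upto k G = a *: G -> G \in self_recips k a.
Proof.
move=> a1 Gi Gk G0 GE.
have a0 : a != 0 by apply: contra_eq_neq a1 => ->; rewrite expr0n eq_sym oner_eq0.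
have sz : size G = k.+1.
  apply/eqP; rewrite eqn_leq; apply/andP; split; first exact/leq_sizeP.
  by rewrite ltnNge; apply/negP => /(nth_default 0); rewrite Gk; apply/eqP/oner_neq0.
have Gg : good G by rewrite /good monicE lead_coefE sz Gk eqxx horner_coef0 G0.
have Gd : deg G = k by rewrite /deg sz.
by rewrite mem_self_recips Gg Gd (@self_recip_rev a k) ?horner_coef0 ?GE ?G0 ?eqxx.
Qed.

(** Multiplying by 'X leaves room for a new outer pair of coefficients, after which
    the former outer pair may be shifted by a free parameter [c].  In degree 0
    there is no such pair, and the polynomials ['X^2 + c *: 'X + 1] are used. *)
Lemma size_self_recips_step a k : a ^+ 2 = 1 ->
  (#|F| * size (self_recips k a) <= size (self_recips k.+2 a))%N.
Proof.
move=> a1.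
have a0 : a != 0 by apply: contra_eq_neq a1 => ->; rewrite expr0n eq_sym oner_eq0.
case: k => [|k].
  case: (posnP (size (self_recips 0 a))) => [->|]; first by rewrite muln0.
  rewrite -has_predT => /hasP[f + _]; rewrite mem_self_recips => /and4P[fg].
  rewrite deg_eq0 // => /eqP -> _; rewrite hornerC => /eqP aE.
  have s1 : (size (self_recips 0 a) <= 1)%N.
    by rewrite (leq_trans _ (size_goods F 0)) // size_filter count_size.
  apply: leq_trans (leq_mul (leqnn _) s1) _.
  pose G c : {poly F} := 'X^2 + c%:P * 'X^1 + 'X^0.
  have GE c i : (G c)`_i = (i == 2)%:R + c * (i == 1)%:R + (i == 0)%:R.
    by rewrite !coefD coefCM !coefXn.
  rewrite muln1 cardE -(size_map G); apply: uniq_leq_size.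
    rewrite map_inj_uniq ?enum_uniq // => c d /(congr1 (fun p : {poly F} => p`_1)).
    by rewrite !GE /= !mulr1 !addr0 !add0r.
  move=> _ /mapP[c _ ->]; apply: self_recips_mono1 => //.
  - by case=> [|[|[|i]]] // _; rewrite GE /= mulr0 !addr0.
  - by rewrite GE /= mulr0 !addr0.
  - by rewrite GE /= mulr0 !add0r.
  rewrite -aE scale1r /G !rev_uptoD rev_uptoC !rev_uptoXn //=.
  by rewrite subnn; ring.
pose G c f : {poly F} :=
  f * 'X + c%:P * ('X^(k.+2) + a%:P * 'X^1) + ('X^(k.+3) + a%:P * 'X^0).
have GE c f i : (G c f)`_i = (if i is j.+1 then f`_j else 0)
    + c * ((i == k.+2)%:R + a * (i == 1)%:R) + ((i == k.+3)%:R + a * (i == 0)%:R).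
  by rewrite !coefD !coefCM !coefD !coefCM !coefXn coefMX; case: i.
have fP f : f \in self_recips k.+1 a -> [/\ good f, deg f = k.+1, f`_0 = a,
    f`_k.+1 = 1 & rev_upto k.+1 f = a *: f].
  rewrite mem_self_recips => /and4P[fg /eqP fk fs /eqP fa].
  split; rewrite -?horner_coef0 -?fk ?coef_deg //.
  by apply/eqP; rewrite -self_recip_rev // fk.
rewrite cardE -(size_allpairs G); apply: uniq_leq_size.
  apply: allpairs_uniq; rewrite ?enum_uniq ?self_recips_uniq //.
  move=> [c f] [d g] /allpairsP[[c' f'] /= [_ f'S [-> ->]]].
  move=> /allpairsP[[d' g'] /= [_ g'S [-> ->]]] /= E.
  have cd : c' = d'.
    have := congr1 (fun p : {poly F} => p`_1) E; rewrite !GE /=.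
    have [_ _ -> _ _] := fP _ f'S; have [_ _ -> _ _] := fP _ g'S.
    by rewrite !mulr0 !addr0 !mulr1 !add0r => /addrI/(mulIf a0).
  move: E; rewrite cd /G => /addIr/addIr /(mulIf _) -> //.
  by rewrite polyX_eq0.
move=> _ /allpairsP[[c f] /= [_ /fP[fg fk f0 f1 fr] ->]].
apply: self_recips_mono1 => //.
- case=> // i ki; have ki' : (k.+2 < i.+1)%N by apply: ltnW.
  have fi : f`_i = 0 by rewrite nth_default // size_good // fk.
  rewrite GE fi (gtn_eqF ki) (gtn_eqF ki').
  by rewrite (gtn_eqF (leq_ltn_trans _ ki')) //= !(mulr0, addr0).
- have fk2 : f`_k.+2 = 0 by rewrite nth_default // size_good // fk.
  rewrite GE fk2 eqxx (gtn_eqF (ltnSn _)).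
  by rewrite /= !(mulr0, addr0, add0r).
- by rewrite GE /= !(mulr0, mulr1, addr0, add0r).
have aa : a%:P * a%:P = 1 :> {poly F} by rewrite -polyCM -expr2 a1.
rewrite /G !rev_uptoD rev_uptoMX (rev_upto_widen 1) ?size_good ?fk // fr.
rewrite !rev_uptoC !rev_uptoD !rev_uptoC !rev_uptoXn // subnn subn0 subSnn.
have -> : (k.+3 - 1 = k.+2)%N by lia.
rewrite -!mul_polyC; transitivity (a%:P * (f * 'X)
  + c%:P * (a%:P * 'X^(k.+2) + a%:P * a%:P * 'X^1)
  + (a%:P * 'X^(k.+3) + a%:P * a%:P * 'X^0)); last by ring.
by rewrite aa; ring.
Qed.

Lemma size_self_recips_steps a k d : a ^+ 2 = 1 ->
  (#|F| ^ d * size (self_recips k a) <= size (self_recips (k + d.*2) a))%N.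
Proof.
move=> a1; elim: d => [|d IH]; first by rewrite mul1n addn0.
rewrite doubleS !addnS; apply: leq_trans (size_self_recips_step _ a1).
by rewrite expnS -mulnA leq_mul2l IH orbT.
Qed.

End OrdinaryReciprocal.

(** * A square-root bound from the recursion *)

Section Growth.
Variables (R : realFieldType) (q : nat) (N : nat -> nat).
Hypothesis q_gt1 : (1 < q)%N.
Hypothesis N_le : forall d, (N d <= q ^ d)%N.
Hypothesis N_rec : forall d,
  (d.*2 * N d <= \sum_(1 <= e < d.+1) N (d - e) * (q ^ e + e * q ^ (e./2).+1))%N.

Definition density d : R := (N d)%:R / q%:R ^+ d.
Definition mass d : R := \sum_(0 <= i < d) density i.

Lemma q_gt0 i : 0 < q%:R ^+ i :> R.
Proof. by rewrite exprn_gt0 // ltr0n ltnW. Qed.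

Lemma density_ge0 d : 0 <= density d.
Proof. by rewrite divr_ge0 ?ler0n // ltW ?q_gt0. Qed.

Lemma density_le1 d : density d <= 1.
Proof. by rewrite ler_pdivrMr ?q_gt0 // mul1r -natrX ler_nat. Qed.

Lemma mass_ge0 d : 0 <= mass d.
Proof. by apply: sumr_ge0 => i _; exact: density_ge0. Qed.

(** The total error in the recursion: 14 is the value of the infinite sum, which
    has a closed form along even truncations. *)
Lemma excess_sum k : \sum_(1 <= e < k.*2.+1) e%:R / 2 ^+ (e.-1)./2
  = 14 - (8 * k%:R + 14) / 2 ^+ k :> R.
Proof.
elim: k => [|k IH]; first by rewrite big_geq // expr0; lra.
rewrite doubleS big_nat_recr // big_nat_recr //= IH uphalf_double doubleK exprS.
have k2 : 2 ^+ k != 0 :> R by rewrite expf_neq0 // pnatr_eq0.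
rewrite -[k.*2.+2%:R]natr1 -[k.*2.+1%:R]natr1 -[k.+1%:R]natr1 -addnn natrD.
by field.
Qed.

Lemma excess_le d : \sum_(1 <= e < d.+1) e%:R / 2 ^+ (e.-1)./2 <= 14 :> R.
Proof.
have pos e : 0 <= e%:R / 2 ^+ (e.-1)./2 :> R.
  by rewrite divr_ge0 ?ler0n // exprn_ge0 // ler0n.
apply: (@le_trans _ _ (\sum_(1 <= e < d.*2.+1) e%:R / 2 ^+ (e.-1)./2)).
  rewrite [leRHS](big_cat_nat (n := d.+1)) ?ltnS -?addnn ?leq_addr //=.
  by rewrite lerDl; apply: sumr_ge0.
rewrite excess_sum gerBl divr_ge0 ?exprn_ge0 ?ler0n //.
by rewrite addr_ge0 ?mulr_ge0 ?ler0n.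
Qed.

(** [N_rec] divided by [q ^ d].  The main term collects the earlier densities with
    weight one; the error needs only that densities are at most 1. *)
Lemma density_rec d : 2 * d%:R * density d <= mass d + 14.
Proof.
have term e : (0 < e)%N -> (e <= d)%N ->
    (N (d - e) * (q ^ e + e * q ^ (e./2).+1))%:R / q%:R ^+ d
    <= density (d - e) + e%:R / 2 ^+ (e.-1)./2 :> R.
  move=> e0 ed.
  have E1 : q%:R ^+ d = q%:R ^+ (d - e) * q%:R ^+ e :> R by rewrite -exprD subnK.
  have E2 : q%:R ^+ e = q%:R ^+ (e./2).+1 * q%:R ^+ (e.-1)./2 :> R.
    by rewrite -exprD; congr (_ ^+ _); lia.
  have n1 := lt0r_neq0 (q_gt0 (d - e)); have n2 := lt0r_neq0 (q_gt0 (e./2).+1).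
  have n3 := lt0r_neq0 (q_gt0 (e.-1)./2).
  have -> : (N (d - e) * (q ^ e + e * q ^ (e./2).+1))%:R / q%:R ^+ d
     = density (d - e) + density (d - e) * (e%:R / q%:R ^+ (e.-1)./2) :> R.
    rewrite natrM natrD natrM !natrX E1 E2 /density; field.
    by rewrite n1 n2 n3.
  rewrite lerD2l; apply: (@le_trans _ _ (e%:R / q%:R ^+ (e.-1)./2)).
    rewrite ler_piMl ?density_le1 // divr_ge0 ?ler0n // ltW ?q_gt0 //.
  rewrite ler_wpM2l ?ler0n // lef_pV2 ?posrE ?q_gt0 ?exprn_gt0 ?ltr0n //.
  by rewrite lerXn2r ?nnegrE ?ler0n // ler_nat.
apply: (@le_trans _ _ (\sum_(1 <= e < d.+1)
    (density (d - e) + e%:R / 2 ^+ (e.-1)./2))).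
  apply: (@le_trans _ _ (\sum_(1 <= e < d.+1)
     (N (d - e) * (q ^ e + e * q ^ (e./2).+1))%:R / q%:R ^+ d)).
    rewrite -big_distrl /= -natr_sum /density mulrA ler_pM2r ?invr_gt0 ?q_gt0 //.
    by rewrite -natrM -natrM ler_nat mul2n.
  rewrite big_nat [leRHS]big_nat; apply: ler_sum => e /andP[e0].
  by rewrite ltnS => ed; apply: term.
rewrite big_split lerD ?excess_le //= le_eqVlt; apply/orP; left; apply/eqP.
rewrite /mass [RHS]big_nat_rev big_add1 /=.
by apply: eq_bigr => i _; rewrite add0n.
Qed.

(** The discrete Gronwall step: [mass d + 14] grows by at most the factor
    [1 + 1 / 2d], so its square grows like the product of the
    [(1 + 1 / 2i) ^+ 2], that is, linearly. *)
Lemma mass_sqr_le d : (0 < d)%N -> (mass d + 14) ^+ 2 <= 225 * (4 * d%:R - 1).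
Proof.
case: d => // d _; elim: d => [|d IH].
  rewrite /mass big_nat1; have := density_le1 0; have := density_ge0 0; nra.
have rec := density_rec d.+1; have M := mass_ge0 d.+1.
have D : 1 <= d.+1%:R :> R by rewrite ler1n.
rewrite [mass d.+2]big_nat_recr //= -/(mass d.+1).
rewrite -[d.+2%:R]natr1; move: (density d.+1) (density_ge0 d.+1) rec M IH D.
move: (mass d.+1) (d.+1%:R : R) => S D x x0 rec S0 IH D1.
have D0 : 0 < D by lra.
have step : 2 * D * (S + x + 14) <= (S + 14) * (2 * D + 1) by lra.
have sq : (2 * D * (S + x + 14)) ^+ 2 <= ((S + 14) * (2 * D + 1)) ^+ 2.
  by rewrite lerXn2r // nnegrE mulr_ge0 ?mulr_ge0 //; lra.
have c1 : (S + 14) ^+ 2 * (2 * D + 1) ^+ 2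
    <= 225 * (4 * D - 1) * (2 * D + 1) ^+ 2.
  by rewrite ler_wpM2r // sqr_ge0.
have DD : 0 < 4 * D ^+ 2 by rewrite mulr_gt0 ?exprn_gt0 //; lra.
rewrite -(ler_pM2l DD).
apply: (@le_trans _ _ (((S + 14) * (2 * D + 1)) ^+ 2)).
  by apply: le_trans sq; rewrite le_eqVlt; apply/orP; left; apply/eqP; ring.
rewrite exprMn; apply: le_trans c1 _.
by nra.
Qed.

Lemma sqr_le_of_mass d (y : R) : (0 < d)%N -> 0 <= y ->
  d%:R * y <= mass d + 14 -> d%:R * y ^+ 2 <= 900.
Proof.
move=> d0 y0 yS; have S := mass_sqr_le d0.
have D0 : 0 < d%:R :> R by rewrite ltr0n.
have sq : (d%:R * y) ^+ 2 <= (mass d + 14) ^+ 2.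
  rewrite lerXn2r // nnegrE ?mulr_ge0 ?ler0n // addr_ge0 ?mass_ge0 ?ler0n //.
rewrite -(ler_pM2l D0).
have -> : d%:R * (d%:R * y ^+ 2) = (d%:R * y) ^+ 2 by ring.
lra.
Qed.

Lemma density_sqr_le d : d.+1%:R * density d ^+ 2 <= 450.
Proof.
have x0 := density_ge0 d; have x1 := density_le1 d.
case: (posnP d) => [-> |d0].
  rewrite mul1r; apply: (@le_trans _ _ (1 ^+ 2)); last by rewrite expr1n ler1n.
  by rewrite lerXn2r ?nnegrE ?ler01 ?density_le1 ?density_ge0.
have := @sqr_le_of_mass d (2 * density d) d0.
rewrite mulr_ge0 ?ler0n // => /(_ isT).
rewrite mulrA [d%:R * 2]mulrC density_rec => /(_ isT).
have D : 1 <= d%:R :> R by rewrite ler1n.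
rewrite -[d.+1%:R]natr1 exprMn; nra.
Qed.

End Growth.

(** * Summing over the degree of the cofactor *)

Section RealBound.
Variable R : realType.

(** At most [m + 1] degrees occur, each contributing [TOT / sqrt n] up to a
    constant; the constant 45 comes from [1800 <= 45 ^ 2]. *)
Lemma sum_level_bound n (m TOT : R) (T : nat -> nat) X :
  (1 <= n)%N -> 0 <= m -> 0 <= TOT ->
  (X <= \sum_(0 <= k < (Num.trunc m).+1) T k)%N ->
  (forall k, k%:R <= m ->
     exists2 y : R, (T k)%:R <= y * TOT & 0 <= y /\ n%:R * y ^+ 2 <= 1800) ->
  X%:R <= 45 * (TOT * (m + 1) / Num.sqrt n%:R).
Proof.
move=> n1 m0 T0 XT Tk.
have sn : 0 < Num.sqrt n%:R :> R by rewrite sqrtr_gt0 ltr0n.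
rewrite !mulrA ler_pdivlMr //.
apply: (@le_trans _ _ ((\sum_(0 <= k < (Num.trunc m).+1) T k)%:R * Num.sqrt n%:R)).
  by rewrite ler_wpM2r ?ler_nat // ltW.
rewrite natr_sum big_distrl /=.
apply: (@le_trans _ _ (\sum_(0 <= k < (Num.trunc m).+1) 45 * TOT)).
  rewrite big_nat [leRHS]big_nat; apply: ler_sum => k /andP[_].
  rewrite ltnS truncn_ge_nat // => km.
  have [y Ty [y0 ny]] := Tk k km.
  apply: (@le_trans _ _ (y * TOT * Num.sqrt n%:R)).
    by rewrite ler_wpM2r // ltW.
  rewrite mulrAC ler_wpM2r //.
  rewrite -(@ler_pXn2r _ 2) ?nnegrE ?mulr_ge0 ?(ltW sn) ?ler0n //.
  by rewrite exprMn sqr_sqrtr ?ler0n // mulrC; lra.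
rewrite sumr_const_nat subn0 -[leLHS]mulr_natr ler_wpM2l ?mulr_ge0 ?ler0n //.
by rewrite -natr1 lerD2r truncn_le.
Qed.

(** This is where the hypothesis [m <= sqrt n] enters: the norm keeps a positive
    proportion of the degree, since [k ^ 2 <= n] gives [2 * k <= n + 1]. *)
Lemma norm_degree_large n k (m : R) : m <= Num.sqrt n%:R -> k%:R <= m ->
  (k <= n)%N -> ~~ odd (n - k) -> (n <= 4 * ((n - k)./2).+1)%N.
Proof.
move=> mn km kn ok.
have : (k ^ 2 <= n)%N.
  rewrite -(ler_nat R) natrX -[leRHS]sqr_sqrtr ?ler0n //.
  by rewrite lerXn2r ?nnegrE ?ler0n ?sqrtr_ge0 // (le_trans km).
by rewrite -mulnn; nia.
Qed.

Variables (F : finFieldType) (phi : {rmorphism F -> F}).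
Hypothesis phiK : involutive phi.

Definition norm_density : nat -> R := density R #|F| (norm_num phi).

Lemma norm_density_bound n d : (n <= 4 * d.+1)%N ->
  0 <= norm_density d /\ n%:R * norm_density d ^+ 2 <= 1800.
Proof.
move=> nd; split; first exact: density_ge0 (finNzRing_gt1 F) d.
have := density_sqr_le R (finNzRing_gt1 F) (norm_num_le phi) (norm_num_rec phiK) d.
rewrite -/(norm_density d) => xd.
apply: (@le_trans _ _ ((4 * d.+1)%:R * norm_density d ^+ 2)).
  by rewrite ler_wpM2r ?sqr_ge0 // ler_nat.
by rewrite natrM -mulrA; lra.
Qed.

Lemma norm_numE d : (norm_num phi d)%:R = norm_density d * #|F|%:R ^+ d :> R.
Proof. by rewrite divfK // expf_neq0 // pnatr_eq0 -lt0n ltnW // finNzRing_gt1. Qed.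

End RealBound.

(** * The two cases *)

Section StarCase.
Variables (R : realType) (F : finFieldType).

Let phi : {rmorphism F -> F} := idfun.
Let phiK : involutive phi. Proof. by []. Qed.

Lemma recip_star f : recip phi f = poly_star f.
Proof. by rewrite /recip map_poly_id. Qed.

Lemma mem_P_star n a (f : {poly_n.+1 F}) :
  (f \in P_star n a) = (polyn f \in self_recips phi n a).
Proof.
rewrite inE mem_self_recips /self_recip recip_star /star_symmetric /good /deg.
case fm: (polyn f \is monic) => //=; have := monic_neq0 fm.
rewrite -size_poly_gt0; case: (size f) => // k _ /=.
by rewrite eqSS; case: (_ != 0); rewrite //= andbF.
Qed.

Lemma card_P_star n a : (size (self_recips phi n a) <= #|P_star n a|)%N.
Proof.
rewrite cardE -(size_map (@polyn F n.+1)); apply: uniq_leq_size.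
  exact: self_recips_uniq.
move=> f fS; have sz : (size f <= n.+1)%N.
  by move: fS; rewrite mem_self_recips => /and4P[fg /eqP <- _ _]; rewrite size_good.
have fE := npolypK sz.
by apply/mapP; exists (npolyp n.+1 f); rewrite ?mem_enum ?mem_P_star ?fE.
Qed.

(** Here norms have constant term 1, so every cofactor has constant term [a]. *)
Lemma star_bound n (m : R) (a : F) :
  (1 <= n)%N -> 0 <= m -> m <= Num.sqrt n%:R -> a = 1 \/ a = -1 ->
  #|[set f in P_star n a | `[< star_factors m (polyn f) >]]|%:R
    <= 45 * (#|P_star n a|%:R * (m + 1) / Num.sqrt n%:R).
Proof.
move=> n1 m0 mn a1; have aa : a ^+ 2 = 1.
  by case: a1 => ->; rewrite ?sqrrN expr1n.
apply: (sum_level_bound (T := factorisations phi n a)) => //.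
  rewrite cardE -(size_map (@polyn F n.+1)).
  apply: size_le_factorisations => //.
    by rewrite map_inj_uniq ?enum_uniq //; exact: val_inj.
  move=> _ /mapP[f + ->]; rewrite mem_enum inE => /andP[fP /asboolP].
  case=> g [h [gm g0 hm hM fE]]; split; first by rewrite -mem_P_star.
  exists g, h; split=> //; first by rewrite /good gm.
    by rewrite /deg truncn_ge_nat.
  by rewrite /norm recip_star.
move=> k km; rewrite /factorisations.
case: ifP => [/andP[kn okn]|_]; last first.
  by exists 0; rewrite ?mul0r // expr0n mulr0 lexx ler0n.
set d := (n - k)./2; have nE : n = (k + d.*2)%N.
  by rewrite /d; move: kn okn; lia.
exists (norm_density R phi d); last first.
  exact/(norm_density_bound R phiK)/(norm_degree_large mn km).
rewrite (_ : (\sum_(s <- norms phi d) _)%N =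
    (norm_num phi d * size (self_recips phi k a))%N); last first.
  rewrite /norm_num -sum1_size big_distrl /= !big_seq; apply: eq_bigr => s.
  case/mem_normsP=> g [gg _ ->].
  by rewrite norm_const // divff ?good_const // divr1 mul1n.
rewrite natrM norm_numE -mulrA ler_wpM2l //.
  by have [] := norm_density_bound R phiK (leqnn (4 * d.+1)).
rewrite -natrX -natrM ler_nat [in leqRHS]nE.
by apply: leq_trans (card_P_star _ _); apply: size_self_recips_steps.
Qed.

End StarCase.

Section DaggerCase.
Variables (R : realType) (F : finFieldType) (q0 : nat).
Hypothesis card_F : #|F| = (q0 ^ 2)%N.

(** [q0] is a power of the characteristic, since its square is; hence raising to
    the power [q0] is additive. *)
Lemma half_frobenius :
  exists phi : {rmorphism F -> F}, forall x, phi x = x ^+ q0.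
Proof.
have [p p_pr charFp] := finPcharP F.
have q1 := q0_gt1 card_F.
have qp : [pchar F].-nat q0.
  have pF : p.-nat #|F|.
    by have := primeChar_pgroup charFp; rewrite /pgroup cardsT.
  rewrite (eq_pnat _ (pcharf_eq charFp)); apply: pnat_dvd pF.
  by rewrite card_F expnS dvdn_mulr.
pose f := fun x : F => x ^+ q0.
have fB : zmod_morphism f.
  move=> x y; apply/eqP; rewrite -subr_eq0 opprB addrA subr_eq0 /f.
  by rewrite -exprDn_pchar // subrK.
have fM : monoid_morphism f by split; [exact: expr1n | move=> x y; exact: exprMn].
pose fa := GRing.isZmodMorphism.Build _ _ f fB.
pose fm := GRing.isMonoidMorphism.Build _ _ f fM.
pose phi : {rmorphism F -> F} := HB.pack f fa fm.
by exists phi.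
Qed.

(** Norms now have varying constant terms, and the cofactor adapts to the norm: a
    cofactor of positive degree has [q0 ^ k.-1] choices whatever its constant
    term.  Only the trivial cofactor imposes a condition on the norm. *)
Lemma dagger_bound n (m : R) (a : F) :
  (1 <= n)%N -> 0 <= m -> m <= Num.sqrt n%:R -> a != 0 ->
  #|[set f in P_dagger q0 n a | `[< dagger_factors q0 m (polyn f) >]]|%:R
    <= 45 * ((#|F|%:R `^ ((n%:R - 1) / 2)) * (m + 1) / Num.sqrt n%:R).
Proof.
move=> n1 m0 mn a0; have [phi phiE] := half_frobenius.
have q1 := q0_gt1 card_F.
have phiK : involutive phi.
  by move=> x; rewrite !phiE -exprM mulnn -card_F expf_card.
have recip_dagger f : recip phi f = poly_dagger q0 f.
  by rewrite /recip /poly_dagger /poly_bar !(eq_map_poly phiE).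
have -> : #|F|%:R `^ ((n%:R - 1) / 2) = q0%:R ^+ n.-1 :> R.
  rewrite card_F natrX -powR_mulrn ?ler0n // -powRrM.
  rewrite -powR_mulrn ?ler0n //; congr (_ `^ _).
  by rewrite mulrCA divff ?pnatr_eq0 // mulr1 -subn1 natrB.
apply: (sum_level_bound (T := factorisations phi n a)) => //.
- by rewrite exprn_ge0 ?ler0n.
- rewrite cardE -(size_map (@polyn F n.+1)).
  apply: size_le_factorisations => //.
    by rewrite map_inj_uniq ?enum_uniq //; exact: val_inj.
  move=> _ /mapP[f + ->]; rewrite mem_enum !inE => /andP[fP /asboolP].
  case=> g [h [gm g0 hm hM fE]]; split.
    move: fP; rewrite mem_self_recips /self_recip recip_dagger => /and4P[fm /eqP fs].
    case/andP=> f0 fd fa; rewrite /good fm f0 fd fa /deg fs eqxx //.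
  exists g, h; split=> //; first by rewrite /good gm.
    by rewrite /deg truncn_ge_nat.
  by rewrite /norm recip_dagger.
move=> k km; rewrite /factorisations.
case: ifP => [/andP[kn okn]|_]; last first.
  by exists 0; rewrite ?mul0r // expr0n mulr0 lexx ler0n.
set d := (n - k)./2; have nE : n = (k + d.*2)%N.
  by rewrite /d; move: kn okn; lia.
case: (posnP k) => [k0|k0]; last first.
  exists (norm_density R phi d); last first.
    exact/(norm_density_bound R phiK)/(norm_degree_large mn km).
  apply: (@le_trans _ _ (norm_num phi d * q0 ^ k.-1)%:R).
    rewrite ler_nat /norm_num -sum1_size big_distrl /=; apply: leq_sum => s _.
    by rewrite mul1n (size_self_recip_const phiE card_F).
  rewrite natrM norm_numE -mulrA ler_wpM2l //.
    by have [] := norm_density_bound R phiK (leqnn (4 * d.+1)).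
  rewrite card_F natrX -exprM -natrX -natrX -natrM -expnD.
  by rewrite (_ : 2 * d + k.-1 = n.-1)%N // nE; lia.
(* With trivial cofactor, the bound for norms of constant term [a] is needed. *)
have d0 : (0 < d)%N by move: n1; rewrite nE k0; lia.
set c := norm_count phi (pred1 a) d.
have Q0 : 0 < q0%:R ^+ n.-1 :> R by rewrite exprn_gt0 // ltr0n ltnW.
exists (c%:R / q0%:R ^+ n.-1).
  rewrite divfK ?gt_eqF // ler_nat k0.
  rewrite /c /norm_count size_filter -sum1_count [leqRHS]big_mkcond /= !big_seq.
  apply: leq_sum => s /mem_normsP[g [gg _ ->]].
  have s0 := good_const (norm_good phi gg).
  apply: (@leq_trans (size [seq f <- goods F 0 | f.[0] == a / (norm phi g).[0]])).
    by rewrite !size_filter; apply: sub_count => f /andP[].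
  rewrite size_goods0_const; case: (_ =P 1); rewrite // => E.
  by rewrite -(divfK s0 a) E mul1r eqxx.
have y0 : 0 <= c%:R / q0%:R ^+ n.-1 :> R by rewrite divr_ge0 ?ler0n // ltW.
split=> //; have := sqr_le_of_mass (finNzRing_gt1 F) (norm_num_le phi)
  (norm_num_rec phiK) d0 y0.
have le14 : mass R #|F| (norm_num phi) d <= mass R #|F| (norm_num phi) d + 14.
  by rewrite lerDl.
move=> H; have {H} : d%:R * (c%:R / q0%:R ^+ n.-1) ^+ 2 <= 900 :> R.
  apply: H; apply: le_trans le14.
  rewrite mulrA ler_pdivrMr //.
  apply: (@le_trans _ _ (\sum_(1 <= e < d.+1) norm_num phi (d - e) * q0 ^ (e.*2.-1))%:R).
    by rewrite -natrM ler_nat norm_count_const.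
  rewrite le_eqVlt; apply/orP; left; apply/eqP.
  rewrite natr_sum /mass [in RHS]big_nat_rev [in LHS]big_add1 big_distrl /= !big_nat.
  apply: eq_bigr => e /andP[_ ed]; rewrite add0n natrM norm_numE /norm_density.
  rewrite -mulrA; congr (_ * _).
  rewrite card_F natrX -exprM natrX -exprD; congr (_ ^+ _).
  by rewrite nE k0; lia.
have -> : n%:R = 2 * d%:R :> R by rewrite nE k0 add0n -mul2n natrM.
by rewrite -mulrA; lra.
Qed.

End DaggerCase.

Theorem proposition2p6 (R : realType) :
  (exists C : R,
    forall (F : finFieldType) (n : nat) (m : R) (a : F),
      (1 <= n)%N -> 0 <= m -> m <= Num.sqrt (n%:R) ->
      a = 1 \/ a = -1 ->
      #|[set f in P_star n a | `[< star_factors m f >]]|%:R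
        <= C * (#|P_star n a|%:R * (m + 1) / Num.sqrt (n%:R)))
  /\
  (exists C : R,
    forall (F : finFieldType) (q0 n : nat) (m : R)
           (U : {group {unit F}}) (a : {unit F}),
      (1 <= n)%N -> 0 <= m -> m <= Num.sqrt (n%:R) ->
      #|F| = (q0 ^ 2)%N ->
      cyclic U -> #|U| = q0.+1 -> a \in U ->
      #|[set f in P_dagger q0 n (val a) | `[< dagger_factors q0 m f >]]|%:R
        <= C * ((#|F|%:R `^ ((n%:R - 1) / 2)) * (m + 1) / Num.sqrt (n%:R))).
Proof.
split; exists 45; first by move=> F n m a; exact: star_bound.
move=> F q0 n m U a n1 m0 mn.
move=> card_F _ _ _; apply: dagger_bound => //.
by have := valP a; rewrite unitfE.
Qed.
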